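(* Let $k\ge1$ be an integer, $\lambda>0$, $0<\alpha\le2$, and $\theta\in\mathbf{R}$ with $|\theta|\le\min(\pi\alpha/2,\ \pi-\pi\alpha/2)$. Then the generalized Linnik law GL$(\alpha,\theta,1/k)$, i.e. the probability law on $\mathbf{R}$ with characteristic function $$\phi(u)=\frac{1}{\left[1+\lambda|u|^{\alpha}e^{-i\theta\,\mathrm{sgn}(u)}\right]^{1/k}},\qquad u\in\mathbf{R},$$ is unimodal.
   Context: A probability law on $\mathbf{R}$ is unimodal if there is a point $m$ such that its distribution function is convex on $(-\infty,m)$ and concave on $(m,\infty)$. The root is the principal branch. It is known that the displayed function is a characteristic function for the stated parameters. *)

(* Defs.v *)
From HB Require Import structures.
From mathcomp Require Import all_boot all_order all_algebra.
From mathcomp Require Import complex.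
From mathcomp Require Import all_classical all_reals all_analysis.
Import Order.TTheory GRing.Theory Num.Theory.
Import numFieldNormedType.Exports.
Import ComplexField.Normc.

Set Implicit Arguments.
Unset Strict Implicit.
Unset Printing Implicit Defensive.

Local Open Scope classical_set_scope.
Local Open Scope ring_scope.
Local Open Scope complex_scope.

(* [expi t] is e^{it}. *)
Definition expi (R : realType) (t : R) : R[i] := cos t +i* sin t.

(* The principal argument, with values in ]-pi, pi]; the value at [0] is
   irrelevant. *)
Definition principal_arg (R : realType) (z : R[i]) : R :=
  if 0 <= complex.Im z then acos (complex.Re z / normc z)
  else - acos (complex.Re z / normc z).

(* The principal branch of [z ^ (1 / k)].  This is not the library's
   [k.-root z], which is normalized by a nonnegative imaginary part instead of
   a principal argument in ]-pi, pi]. *)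
Definition principal_root (R : realType) (k : nat) (z : R[i]) : R[i] :=
  (normc z `^ k%:R^-1)%:C * expi (principal_arg z / k%:R).

Definition char_fun (R : realType) (mu : probability (measurableTypeR R) R)
    (u : R) : R[i] :=
  (\int[mu]_x complex.Re (expi (u * x))) +i*
  (\int[mu]_x complex.Im (expi (u * x))).

Definition dist_fun (R : realType) (mu : probability (measurableTypeR R) R)
    (x : R) : R :=
  fine (mu `]-oo, x]%classic).

Definition unimodal (R : realType) (mu : probability (measurableTypeR R) R) :
    Prop :=
  exists m : R,
    convex_function (E := R^o) `]-oo, m[%classic (dist_fun mu) /\
    convex_function (E := R^o) `]m, +oo[%classic (fun x => - dist_fun mu x).

Definition linnik_cf (R : realType) (lambda alpha theta : R) (k : nat) (u : R) :
    R[i] :=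
  1 / principal_root k
        (1 + (lambda * `|u| `^ alpha)%:C * expi (- theta * Num.sg u)).

(* Main.v *)
Require Import Defs.
From HB Require Import structures.
From mathcomp Require Import all_boot all_order all_algebra.
From mathcomp Require Import complex.
From mathcomp Require Import all_classical all_reals all_analysis.
From mathcomp Require Import measurable_realfun.
From mathcomp Require Import ring lra.
Import Order.TTheory GRing.Theory Num.Theory.
Import numFieldNormedType.Exports.

(** The mode is 0.  For [b > 0] convolve the law with the distribution of a
    negative Gamma variable, of density [|y| e^{b y}] (up to a factor) on
    [y < 0].  Its Fourier transform [1 / (b + i u)^2] is integrable, so the
    smoothed law has, up to a constant, the density
      [q(t) = Re \int_0^oo e^{-i t u} phi(u) / (b + i u)^2 du].
    For [t > 0] the half-line can be rotated to the negative imaginary axis,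
    [u = - i r]: since the kernel sits on the negative half-line, its transform
    stays positive there, and
      [q(t) = \int_0^oo e^{- t r} Im phi(- i r) / (b + r)^2 dr],
    where [Im phi(- i r) >= 0] because the argument of
    [1 + lambda r^alpha e^{- i (pi alpha / 2 + theta)}] lies in [-pi, 0].  Hence
    [q] is nonincreasing on [t > 0], the smoothed distribution function is
    concave there, and letting [b] tend to infinity removes the smoothing.  When
    [pi alpha / 2 + theta = pi] the rotated integrand has a pole or a branch
    point on the imaginary axis, and one perturbs [theta] instead.  The negative
    half-line is treated by reflection, which turns [theta] into [- theta].

    In real terms, an analytic function of [u = r e^{- i beta}] is written
    [exp (p + i psi)], and rotating the contour amounts to the Cauchy-Riemann
    identity
      [d/dbeta (e^p cos psi) = d/dr (r e^p sin psi)]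
    (the factor [du = e^{- i beta} dr] being included in [psi]). *)

Set Implicit Arguments.
Unset Strict Implicit.
Unset Printing Implicit Defensive.

Local Open Scope classical_set_scope.
Local Open Scope ring_scope.

(** * The argument in the slit plane *)

Section derive_fun.
Context {R : realType}.

Lemma is_derive_compR (g f : R -> R) (x a b : R) :
  is_derive (f x) 1 g a -> is_derive x 1 f b ->
  is_derive x 1 (fun z => g (f z)) (a * b).
Proof. exact: is_derive1_comp. Qed.

(** These chain rules are instances so that [is_derive_eq] and [ex_derive] differentiate composite
    expressions by instance resolution. *)
#[export] Instance is_derive_expR_fun (f : R -> R) (x b : R) :
  is_derive x 1 f b -> is_derive x 1 (fun z => expR (f z)) (expR (f x) * b).
Proof. by move=> h; apply: is_derive_compR. Qed.

#[export] Instance is_derive_cos_fun (f : R -> R) (x b : R) :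
  is_derive x 1 f b -> is_derive x 1 (fun z => cos (f z)) (- sin (f x) * b).
Proof. by move=> h; apply: is_derive_compR. Qed.

#[export] Instance is_derive_sin_fun (f : R -> R) (x b : R) :
  is_derive x 1 f b -> is_derive x 1 (fun z => sin (f z)) (cos (f x) * b).
Proof. by move=> h; apply: is_derive_compR. Qed.

#[export] Instance is_derive_atan_fun (f : R -> R) (x b : R) :
  is_derive x 1 f b ->
  is_derive x 1 (fun z => atan (f z)) ((1 + f x ^+ 2)^-1 * b).
Proof. by move=> h; apply: is_derive_compR. Qed.

Lemma derivable_continuous_at (f : R -> R) (x : R) :
  derivable f x 1 -> {for x, continuous f}.
Proof.
by move=> df; apply: differentiable_continuous; exact/derivable1_diffP.
Qed.

Lemma derivable_measurable_fun (f : R -> R) :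
  (forall x, derivable f x 1) -> measurable_fun setT f.
Proof.
move=> df; apply: continuous_measurable_fun => x.
exact: derivable_continuous_at.
Qed.

End derive_fun.

Section carg.
Context {R : realType}.
Implicit Types X Y x : R.

Definition cabs X Y := Num.sqrt (X ^+ 2 + Y ^+ 2).

(** Half-angle formula for the principal argument of X + iY. It is differentiable, without case
    distinction, wherever [cabs X Y + X] is positive, that is off the half-line Y = 0, X <= 0. *)
Definition carg X Y := 2 * atan (Y / (cabs X Y + X)).

Lemma cabs_ge0 X Y : 0 <= cabs X Y.
Proof. exact: sqrtr_ge0. Qed.

Lemma cabs_sqr X Y : cabs X Y ^+ 2 = X ^+ 2 + Y ^+ 2.
Proof. by rewrite sqr_sqrtr// addr_ge0// sqr_ge0. Qed.

Lemma cabs_gt0 X Y : 0 < cabs X Y + X -> 0 < cabs X Y.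
Proof.
move=> h; rewrite lt_neqAle cabs_ge0 andbT eq_sym; apply/eqP => h0.
have := cabs_sqr X Y; rewrite h0 expr0n/= => /esym/eqP.
rewrite paddr_eq0 ?sqr_ge0// => /andP[/eqP]/eqP; rewrite sqrf_eq0 => /eqP X0 _.
by move: h; rewrite h0 X0 addr0 ltxx.
Qed.

Lemma slit_pos X Y : 0 < X -> 0 < cabs X Y + X.
Proof. by move=> X0; rewrite ltr_wpDl// cabs_ge0. Qed.

Lemma slit_im X Y : Y != 0 -> 0 < cabs X Y + X.
Proof.
move=> Y0; rewrite -ltrBlDr sub0r.
have [X0|X0] := lerP 0 X.
  rewrite (@le_lt_trans _ _ 0) ?oppr_le0//.
  by rewrite sqrtr_gt0 ltr_wpDl ?sqr_ge0// exprn_even_gt0.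
rewrite -(@ltr_pXn2r _ 2)// ?nnegrE ?cabs_ge0 ?oppr_ge0 ?(ltW X0)//.
by rewrite cabs_sqr sqrrN ltrDl exprn_even_gt0.
Qed.

Lemma cos_carg X Y : 0 < cabs X Y + X -> cos (carg X Y) = X / cabs X Y.
Proof.
move=> h; rewrite /carg mulr_natl cos_mulr2n cos_atan.
have N0 := cabs_gt0 h.
have Nsq := cabs_sqr X Y.
rewrite exprVn sqr_sqrtr ?addr_ge0 ?sqr_ge0//.
(* The ratio is the tangent of the half angle. With N the modulus, Y^2 = (N - X)(N + X) gives the
   identity. *)
have -> : 1 + (Y / (cabs X Y + X)) ^+ 2 = 2 * cabs X Y / (cabs X Y + X).
  rewrite expr_div_n.
  have -> : Y ^+ 2 = cabs X Y ^+ 2 - X ^+ 2 by rewrite Nsq; ring.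
  by field; rewrite gt_eqF.
by field; rewrite !gt_eqF.
Qed.

Lemma sin_carg X Y : 0 < cabs X Y + X -> sin (carg X Y) = Y / cabs X Y.
Proof.
move=> h; rewrite /carg mulr_natl sin_mulr2n.
set z := Y / _.
have c0 : cos (atan z) != 0.
  by rewrite gt_eqF// cos_gt0_pihalf// atan_gtNpi2 atan_ltpi2.
have -> : sin (atan z) = z * cos (atan z).
  by rewrite -{2}(atanK z) /tan divfK.
have N0 := cabs_gt0 h.
have Nsq := cabs_sqr X Y.
rewrite mulrCA -expr2 cos_atan exprVn sqr_sqrtr ?addr_ge0 ?sqr_ge0//.
have -> : 1 + z ^+ 2 = 2 * cabs X Y / (cabs X Y + X).
  rewrite expr_div_n.
  have -> : Y ^+ 2 = cabs X Y ^+ 2 - X ^+ 2 by rewrite Nsq; ring.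
  by field; rewrite gt_eqF.
by rewrite /z; field; rewrite !gt_eqF.
Qed.

Lemma carg_itv X Y : - pi < carg X Y < pi.
Proof.
rewrite /carg; have := atan_gtNpi2 (Y / (cabs X Y + X)).
have := atan_ltpi2 (Y / (cabs X Y + X)); lra.
Qed.

Lemma carg_ge0 X Y : 0 < cabs X Y + X -> 0 <= Y -> 0 <= carg X Y.
Proof.
move=> h Y0; rewrite /carg mulr_ge0//.
by rewrite -[leLHS]atan0 le_atan// divr_ge0// ltW.
Qed.

Lemma cargN X Y : carg X (- Y) = - carg X Y.
Proof. by rewrite /carg /cabs sqrrN mulNr atanN mulrN. Qed.

Lemma is_derive_ln_sqn (X Y : R -> R) x (dX dY : R) :
  is_derive x 1 X dX -> is_derive x 1 Y dY -> 0 < cabs (X x) (Y x) ->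
  is_derive x 1 (fun z => ln (X z ^+ 2 + Y z ^+ 2))
    (2 * (X x * dX + Y x * dY) / (X x ^+ 2 + Y x ^+ 2)).
Proof.
move=> hX hY N0.
have S0 : 0 < X x ^+ 2 + Y x ^+ 2 by rewrite -cabs_sqr exprn_gt0.
have h1 : is_derive x 1 (fun z => X z ^+ 2 + Y z ^+ 2)
    (2 * (X x * dX + Y x * dY)).
  apply: is_derive_eq; rewrite /GRing.scale/=; ring.
have h2 := is_derive1_ln S0.
have h3 := is_derive1_comp (g := fun z => X z ^+ 2 + Y z ^+ 2) h2 h1.
by apply: (is_derive_eq h3); rewrite mulrC.
Qed.

Lemma is_derive_cabs (X Y : R -> R) x (dX dY : R) :
  is_derive x 1 X dX -> is_derive x 1 Y dY -> 0 < cabs (X x) (Y x) ->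
  is_derive x 1 (fun z => cabs (X z) (Y z))
    ((X x * dX + Y x * dY) / cabs (X x) (Y x)).
Proof.
move=> hX hY N0.
have S0 : 0 < X x ^+ 2 + Y x ^+ 2 by rewrite -cabs_sqr exprn_gt0.
have h1 : is_derive x 1 (fun z => X z ^+ 2 + Y z ^+ 2)
    (2 * (X x * dX + Y x * dY)).
  apply: is_derive_eq; rewrite /GRing.scale/=; ring.
have h2 := is_derive1_sqrt S0.
have h3 := is_derive1_comp (g := fun z => X z ^+ 2 + Y z ^+ 2) h2 h1.
apply: (is_derive_eq h3); rewrite -/(cabs (X x) (Y x)).
by field; rewrite gt_eqF.
Qed.

Lemma is_derive_carg (X Y : R -> R) x (dX dY : R) :
  is_derive x 1 X dX -> is_derive x 1 Y dY ->
  0 < cabs (X x) (Y x) + X x ->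
  is_derive x 1 (fun z => carg (X z) (Y z))
    ((X x * dY - Y x * dX) / (X x ^+ 2 + Y x ^+ 2)).
Proof.
move=> hX hY h; have N0 := cabs_gt0 h.
have hN := is_derive_cabs hX hY N0.
have Nsq := cabs_sqr (X x) (Y x).
have h1 : is_derive x 1 (fun z => cabs (X z) (Y z) + X z)
   ((X x * dX + Y x * dY) / cabs (X x) (Y x) + dX) by apply: is_deriveD.
have h1' := is_deriveV (f := fun z => cabs (X z) (Y z) + X z) (lt0r_neq0 h) h1.
have h2 := is_deriveM (f := Y) hY h1'.
have h3 := is_derive1_atan (Y x / (cabs (X x) (Y x) + X x)).
have h4 := is_derive1_comp (g := fun z => Y z / (cabs (X z) (Y z) + X z)) h3 h2.
have h5 := is_deriveZ 2 h4.
apply: (is_derive_eq h5).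
rewrite /GRing.scale/=.
have -> : 1 + (Y x / (cabs (X x) (Y x) + X x)) ^+ 2 =
     2 * cabs (X x) (Y x) / (cabs (X x) (Y x) + X x).
  rewrite expr_div_n.
  have -> : Y x ^+ 2 = cabs (X x) (Y x) ^+ 2 - X x ^+ 2 by rewrite Nsq; ring.
  by field; rewrite gt_eqF.
rewrite -Nsq.
have Ysq : Y x ^+ 2 = cabs (X x) (Y x) ^+ 2 - X x ^+ 2 by rewrite Nsq; ring.
set N := cabs (X x) (Y x) in Ysq h N0 *.
field: Ysq.
by rewrite !gt_eqF.
Qed.

End carg.

(** * Real-valued integration *)

Section real_integral.
Context d {T : measurableType d} {R : realType}.
Variable mu : {measure set T -> \bar R}.
Implicit Types (D : set T) (f g : T -> R).

Lemma le_integrableR D f g : measurable D -> measurable_fun D f ->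
  (forall x, D x -> `|f x| <= g x) -> mu.-integrable D (EFin \o g) ->
  mu.-integrable D (EFin \o f).
Proof.
move=> mD mf fg; apply: le_integrable => //; first exact/measurable_EFinP.
by move=> x Dx; rewrite /= lee_fin (le_trans (fg x Dx))// ler_norm.
Qed.

Lemma integrable_mull D f (r : R) : measurable D ->
  mu.-integrable D (EFin \o f) ->
  mu.-integrable D (EFin \o (fun x => r * f x)).
Proof. by move=> mD intf; exact: (integrableZl mD r intf). Qed.

Lemma integrable_add D f g : measurable D ->
  mu.-integrable D (EFin \o f) -> mu.-integrable D (EFin \o g) ->
  mu.-integrable D (EFin \o (fun x => f x + g x)).
Proof. by move=> mD intf intg; exact: (integrableD mD intf intg). Qed.

Lemma integrable_sub D f g : measurable D ->
  mu.-integrable D (EFin \o f) -> mu.-integrable D (EFin \o g) ->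
  mu.-integrable D (EFin \o (fun x => f x - g x)).
Proof. by move=> mD intf intg; exact: (integrableB mD intf intg). Qed.

Lemma EFin_Rintegral D f : measurable D -> mu.-integrable D (EFin \o f) ->
  (\int[mu]_(x in D) f x)%:E = (\int[mu]_(x in D) (f x)%:E)%E.
Proof. by move=> mD intf; rewrite fineK//; exact: integrable_fin_num. Qed.

Lemma cvg_Rintegral_dominated D (f_ : (T -> R)^nat) f g : measurable D ->
  (forall n, measurable_fun D (f_ n)) ->
  (forall x, D x -> f_ ^~ x @ \oo --> f x) ->
  mu.-integrable D (EFin \o g) ->
  (forall n x, D x -> `|f_ n x| <= g x) ->
  mu.-integrable D (EFin \o f) /\
  \int[mu]_(x in D) f_ n x @[n --> \oo] --> \int[mu]_(x in D) f x.
Proof.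
move=> mD mf ff ig fg.
have mf' : measurable_fun D (EFin \o f).
  by apply/measurable_EFinP; exact: measurable_fun_cvg mf ff.
have ff' x : D x -> (EFin \o f_ n) x @[n --> \oo] --> (EFin \o f) x.
  by move=> Dx; apply: cvg_EFin; [exact: nearW|exact: ff].
have [i1 _ c1] := @dominated_convergence _ _ _ mu _ mD
  (fun n => EFin \o f_ n) (EFin \o f) (EFin \o g)
  (fun n => (measurable_EFinP _ _).2 (mf n)) mf' (aeW _ ff') ig
  (aeW _ (fun x n Dx => fg n x Dx)).
split => //.
apply: fine_cvg; rewrite fineK//.
exact: integrable_fin_num.
Qed.

End real_integral.

(** * Fubini's theorem for real integrals under a product bound *)

Section fubini.
Context d1 d2 {T1 : measurableType d1} {T2 : measurableType d2} {R : realType}.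
Variables (m1 : {sigma_finite_measure set T1 -> \bar R}).
Variables (m2 : {sigma_finite_measure set T2 -> \bar R}).

(** The bound integrates to a product of two finite integrals, so Tonelli's theorem gives
    integrability on the product space. *)
Lemma Rintegral_fubini (D1 : set T1) (D2 : set T2) (f : T1 -> T2 -> R)
    (g : T1 -> R) (h : T2 -> R) :
  measurable D1 -> measurable D2 ->
  measurable_fun [set: T1 * T2] (fun z => f z.1 z.2) ->
  m1.-integrable D1 (EFin \o g) -> m2.-integrable D2 (EFin \o h) ->
  (forall x y, D1 x -> D2 y -> `|f x y| <= g x * h y) ->
  \int[m1]_(x in D1) \int[m2]_(y in D2) f x y =
  \int[m2]_(y in D2) \int[m1]_(x in D1) f x y.
Proof.
move=> mD1 mD2 mf ig ih fgh.
have mfx x : measurable_fun setT (f x).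
  exact: (measurableT_comp mf (pair1_measurable x)).
have mfy y : measurable_fun setT (f ^~ y).
  exact: (measurableT_comp mf (pair2_measurable y)).
have ifx x : D1 x -> m2.-integrable D2 (EFin \o f x).
  move=> D1x; apply: (@le_integrableR _ _ _ _ _ _ (fun y => g x * h y)) => //.
  - exact: measurable_funTS.
  - by move=> y D2y; exact: fgh.
  - exact: (integrableZl mD2 (g x) ih).
have ify y : D2 y -> m1.-integrable D1 (EFin \o f ^~ y).
  move=> D2y; apply: (@le_integrableR _ _ _ _ _ _ (fun x => h y * g x)) => //.
  - exact: measurable_funTS.
  - by move=> x D1x; rewrite mulrC; exact: fgh.
  - exact: (integrableZl mD1 (h y) ig).
(* Extension by zero reduces the statement to integrals over the whole spaces. *)
pose F (z : T1 * T2) := ((fun z => (f z.1 z.2)%:E) \_ (D1 `*` D2)) z.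
have mF : measurable_fun setT F.
  apply/(measurable_restrictT _ _).1; first exact: measurableX.
  by apply: measurable_funTS; exact/measurable_EFinP.
have FE x y : F (x, y) = if (x \in D1) && (y \in D2) then (f x y)%:E else 0%E.
  rewrite /F patchE/= .
  have -> : ((x, y) \in D1 `*` D2) = (x \in D1) && (y \in D2).
    by apply/idP/andP => [|[]]; rewrite !inE.
  by [].
have iF : (m1 \x m2)%E.-integrable setT F.
  apply/integrable12ltyP => //.
  have [/measurable_EFinP mg goo] := integrableP _ _ _ ig.
  have [/measurable_EFinP mh hoo] := integrableP _ _ _ ih.
  pose H := (\int[m2]_(y in D2) `|(h y)%:E|)%E.
  have H0 : (0 <= H)%E by exact: integral_ge0.
  pose G x := (H * ((fun x => `|(g x)%:E|) \_ D1) x)%E.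
  have mG' : measurable_fun setT ((fun x => `|(g x)%:E|) \_ D1)%E.
    apply/(measurable_restrictT _ _).1 => //.
    by apply/measurable_EFinP; exact: measurableT_comp.
  apply: (@le_lt_trans _ _ (\int[m1]_x G x)%E).
    apply: ge0_le_integral => //.
    - by move=> x _; exact: integral_ge0.
    - apply: (measurable_fun_fubini_tonelli_F (fun z => `|F z|%E)) => //.
      exact: measurableT_comp.
    - exact: emeasurable_funM.
    - move=> x _; rewrite /G patchE; case: ifPn => xD1; last first.
        rewrite mule0; under eq_integral do rewrite FE (negbTE xD1)/= ?normr0 ?abse0.
        by rewrite integral0.
      rewrite muleC -ge0_integralZl//; last first.
        by apply/measurable_EFinP; exact: measurableT_comp.
      rewrite [leRHS]integral_mkcond; apply: ge0_le_integral => //.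
      - by apply: measurableT_comp => //; exact: (measurable_fun_pair2 x mF).
      - apply/(measurable_restrictT _ _).1 => //.
        apply: emeasurable_funM => //.
        by apply/measurable_EFinP; exact: measurableT_comp.
      - move=> y _; rewrite FE xD1/= patchE; case: ifPn => yD2; last first.
          by rewrite abse0.
        rewrite -EFinM lee_fin -normrM.
        rewrite (le_trans (fgh x y _ _)) ?ler_norm//; exact: set_mem.
  rewrite ge0_integralZl//; last by move=> x _; rewrite patchE; case: ifPn.
  rewrite -integral_mkcond; apply: lte_mul_pinfty => //.
  by rewrite ge0_fin_numE.
have Fub := Fubini iF.
have E1 : (\int[m1]_x \int[m2]_y F (x, y) =
   \int[m1]_(x in D1) (\int[m2]_(y in D2) f x y)%:E)%E.
  rewrite [RHS]integral_mkcond; apply: eq_integral => x _.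
  rewrite patchE; case: ifPn => xD1.
    rewrite EFin_Rintegral//; last by apply: ifx; exact: set_mem.
    rewrite [RHS]integral_mkcond; apply: eq_integral => y _.
    by rewrite FE xD1/= patchE; case: ifPn.
  under eq_integral do rewrite FE (negbTE xD1)/=.
  by rewrite integral0.
have E2 : (\int[m2]_y \int[m1]_x F (x, y) =
   \int[m2]_(y in D2) (\int[m1]_(x in D1) f x y)%:E)%E.
  rewrite [RHS]integral_mkcond; apply: eq_integral => y _.
  rewrite patchE; case: ifPn => yD2.
    rewrite EFin_Rintegral//; last by apply: ify; exact: set_mem.
    rewrite [RHS]integral_mkcond; apply: eq_integral => x _.
    by rewrite FE yD2/= andbT patchE; case: ifPn.
  under eq_integral do rewrite FE (negbTE yD2)/= andbF.
  by rewrite integral0.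
by congr fine; rewrite -E1 -E2.
Qed.

End fubini.

(** * The fundamental theorem of calculus on segments and half-lines *)

Section ftc.
Context {R : realType}.
Let mu := @lebesgue_measure R.
Implicit Types (f F : R -> R) (a b l : R).

Lemma Rintegral_FTC2 f F a b : a <= b ->
  (forall x, a <= x <= b -> is_derive x 1 F (f x)) ->
  {within `[a, b], continuous f} ->
  \int[mu]_(x in `[a, b]) f x = F b - F a.
Proof.
rewrite le_eqVlt => /predU1P[<- _ _|ab dF cf].
  by rewrite subrr set_itv1 Rintegral_set1.
have cF x : a <= x <= b -> {for x, continuous F}.
  by move=> /dF [dFx _]; apply: differentiable_continuous; exact/derivable1_diffP.
rewrite /Rintegral (@continuous_FTC2 _ f F)//.
- split.
  + move=> x; rewrite in_itv/= => /andP[ax xb].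
    by have [] : is_derive x 1 F (f x) by apply: dF; rewrite !ltW.
  + by apply: cvg_at_right_filter; apply: cF; rewrite lexx ltW.
  + by apply: cvg_at_left_filter; apply: cF; rewrite lexx ltW.
- move=> x; rewrite in_itv/= => /andP[ax xb].
  have /@derive_val : is_derive x 1 F (f x) by apply: dF; rewrite !ltW.
  by rewrite derive1E.
Qed.

Lemma ge0_integrable_FTC2y f F a l :
  (forall x, a <= x -> 0 <= f x) ->
  (forall x, a <= x -> is_derive x 1 F (f x)) ->
  (forall x, a <= x -> {for x, continuous f}) ->
  F x @[x --> +oo] --> l ->
  mu.-integrable `[a, +oo[ (EFin \o f).
Proof.
move=> f0 dF cf Fl.
have cF x : a <= x -> {for x, continuous F}.
  by move=> /dF [dFx _]; apply: differentiable_continuous; exact/derivable1_diffP.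
have cf' : {within `[a, +oo[, continuous f}.
  apply/continuous_within_itvcyP; split.
    by move=> x; rewrite in_itv/= andbT => /ltW/cf.
  by apply: cvg_at_right_filter; exact: cf.
apply/integrableP; split.
  apply/measurable_EFinP; apply: subspace_continuous_measurable_fun => //.
have -> : (\int[mu]_(x in `[a, +oo[) `|(EFin \o f) x|)%E =
  (\int[mu]_(x in `[a, +oo[) (f x)%:E)%E.
  apply: eq_integral => x; rewrite inE/= in_itv/= andbT => ax.
  by rewrite ger0_norm// f0.
rewrite (@ge0_continuous_FTC2y _ f F a l)//; first by rewrite -EFinB ltry.
- by move=> x /ltW/dF[].
- by apply: cvg_at_right_filter; exact: cF.
- move=> x; rewrite in_itv/= andbT => /ltW/dF /@derive_val.
  by rewrite derive1E.
Qed.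

(** No sign is assumed on [f]: the theorem is applied on [a, a + n], and dominated convergence with
    bound |f| passes to the limit. *)
Lemma Rintegral_FTC2y f F a l :
  (forall x, a <= x -> is_derive x 1 F (f x)) ->
  (forall x, a <= x -> {for x, continuous f}) ->
  mu.-integrable `[a, +oo[ (EFin \o f) ->
  F x @[x --> +oo] --> l ->
  \int[mu]_(x in `[a, +oo[) f x = l - F a.
Proof.
move=> dF cf intf Fl.
pose f_ n := f \_ `[a, a + n%:R].
have [|||||_ c1] := @cvg_Rintegral_dominated _ _ _ mu `[a, +oo[ f_ f (fun x => `|f x|).
- by [].
- move=> n; apply/measurable_restrict => //.
  by apply/measurable_EFinP; apply: measurable_funS (measurable_int _ intf).
- move=> x; rewrite /= in_itv/= andbT => ax.
  apply: cvg_near_cst; near=> n.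
  rewrite /f_ patchE ifT// inE/= in_itv/= ax/=.
  rewrite -lerBlDl; near: n; exact: nbhs_infty_ger.
- exact: (integrable_norm intf).
- by move=> n x _; rewrite /f_ patchE; case: ifPn => // _; rewrite normr0.
apply: (cvg_unique _ c1) => //.
have E n : \int[mu]_(x in `[a, +oo[) f_ n x = F (a + n%:R) - F a.
  rewrite /f_ -Rintegral_mkcondr.
  rewrite (_ : _ `&` _ = `[a, a + n%:R]%classic); last first.
    apply: setIidr => x/=; rewrite !in_itv/= andbT => /andP[]//.
  apply: Rintegral_FTC2.
  - by rewrite lerDl.
  - by move=> x /andP[/dF].
  - apply: continuous_in_subspaceT => x; rewrite inE/= in_itv/= => /andP[ax _].
    exact: cf.
suff : F (a + n%:R) - F a @[n --> \oo] --> l - F a.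
  by under eq_fun do rewrite -E.
apply: cvgB; last exact: cvg_cst.
apply: cvg_comp Fl.
apply/cvgryPge => r.
by near do rewrite -lerBlDl; exact: nbhs_infty_ger.
Unshelve. all: end_near. Qed.

End ftc.

(** * Fourier inversion for the one-sided kernel *)

Section half_line.
Context {R : realType}.
Let mu := @lebesgue_measure R.
Let I : set R := `[0, +oo[%classic.

Let mI : measurable I. Proof. exact: measurable_itv. Qed.

Lemma cvgy_mulr (f : R -> R) (c : R) : 0 < c ->
  f x @[x --> +oo] --> +oo -> c * f x @[x --> +oo] --> +oo.
Proof.
move=> c0 /cvgryPge fy; apply/cvgryPge => r.
near=> x; rewrite -ler_pdivrMl//; near: x; exact: fy.
Unshelve. all: end_near. Qed.

Lemma cvgy_expRN (b : R) : 0 < b -> expR (- b * x) @[x --> +oo] --> (0 : R).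
Proof.
move=> b0; have h : b * x @[x --> +oo] --> +oo by apply: cvgy_mulr => //; exact: cvg_id.
by under eq_fun do rewrite mulNr; exact: (cvg_comp _ _ h (@cvgr_expR R)).
Qed.

(** The factor v is traded for half of the decay rate, by x <= e^x at x = b v / 2. *)
Lemma id_expRN_le (b v : R) : 0 < b ->
  v * expR (- b * v) <= 2 / b * expR (- (b / 2) * v).
Proof.
move=> b0.
have -> : - b * v = - (b / 2) * v + - (b / 2) * v by field.
rewrite expRD mulrA ler_wpM2r ?expR_ge0//.
rewrite mulNr expRN ler_pdivrMr ?expR_gt0//.
have := expR_ge1Dx (b / 2 * v) => h.
rewrite -ler_pdivrMl ?divr_gt0//.
apply: le_trans h.
rewrite invf_div mulrC; lra.
Qed.

Lemma cvgy_id_expRN (b : R) : 0 < b ->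
  x * expR (- b * x) @[x --> +oo] --> (0 : R).
Proof.
move=> b0.
apply: (@squeeze_cvgr _ _ _ _ (cst 0) (fun x => 2 / b * expR (- (b / 2) * x))).
- near=> x; rewrite id_expRN_le// andbT mulr_ge0 ?expR_ge0//.
- exact: cvg_cst.
- rewrite -[X in _ --> X](mulr0 (2 / b)); apply: cvgM; first exact: cvg_cst.
  by apply: cvgy_expRN; rewrite divr_gt0.
Unshelve. all: end_near. Qed.

Lemma integrable_expRN (b : R) : 0 < b ->
  mu.-integrable I (EFin \o (fun x => expR (- b * x))).
Proof.
move=> b0.
apply: (@ge0_integrable_FTC2y _ _ (fun x => - (expR (- b * x) / b)) 0 0).
- by move=> x _; exact: expR_ge0.
- move=> x _; apply: is_derive_eq; rewrite /GRing.scale/=; field.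
  by rewrite gt_eqF.
- by move=> x _; apply: derivable_continuous_at; exact: ex_derive.
- rewrite -[X in _ --> X]oppr0; apply: cvgN.
  rewrite -[X in _ --> X](mul0r b^-1); apply: cvgM; last exact: cvg_cst.
  exact: cvgy_expRN.
Qed.

Lemma integrable_id_expRN (b : R) : 0 < b ->
  mu.-integrable I (EFin \o (fun x => x * expR (- b * x))).
Proof.
move=> b0.
apply: (@le_integrableR _ _ R mu I _ (fun x => 2 / b * expR (- (b / 2) * x))) => //.
- by apply: measurable_funTS; apply: derivable_measurable_fun => x; exact: ex_derive.
- move=> x; rewrite /I/= in_itv/= andbT => x0.
  by rewrite ger0_norm ?mulr_ge0 ?expR_ge0// id_expRN_le.
- have h : 0 < b / 2 by rewrite divr_gt0.
  by apply: integrable_mull => //; exact: integrable_expRN.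
Qed.

Lemma sqrD_gt0 (b u : R) : 0 < b -> 0 < b ^+ 2 + u ^+ 2.
Proof. by move=> b0; rewrite ltr_wpDr ?sqr_ge0// exprn_gt0. Qed.

Lemma integrable_invsqrD (b : R) : 0 < b ->
  mu.-integrable I (EFin \o (fun u => (b ^+ 2 + u ^+ 2)^-1)).
Proof.
move=> b0.
have h u : b ^+ 2 + u ^+ 2 != 0 by rewrite gt_eqF// sqrD_gt0.
apply: (@ge0_integrable_FTC2y _ _ (fun x => atan (b^-1 * x) / b) 0 (pi / 2 / b)).
- by move=> x _; rewrite invr_ge0 ltW// sqrD_gt0.
- move=> x _; apply: is_derive_eq; rewrite /GRing.scale/=; field.
  by rewrite h gt_eqF// andbT addrC; have := h x; rewrite addrC.
- move=> x _; apply: derivable_continuous_at.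
  by have := h x => ?; exact: ex_derive.
- apply: cvgM; last exact: cvg_cst.
  have h2 : b^-1 * x @[x --> +oo] --> +oo.
    by apply: cvgy_mulr; [rewrite invr_gt0|exact: cvg_id].
  exact: (cvg_comp _ _ h2 (@cvgy_atan R)).
Qed.

Lemma cvgy_bounded_mul (f g : R -> R) (M : R) : (forall x, `|g x| <= M) ->
  f x @[x --> +oo] --> (0 : R) -> f x * g x @[x --> +oo] --> (0 : R).
Proof.
move=> gM f0; apply: norm_cvg0.
apply: (@squeeze_cvgr _ _ _ _ (cst 0) (fun x => `|f x| * M)).
- by near=> x; rewrite normr_ge0 normrM ler_wpM2l.
- exact: cvg_cst.
- rewrite -[X in _ --> X](mul0r M) -[X in X * M](@normr0 _ R).
  by apply: cvgM; [exact: cvg_norm|exact: cvg_cst].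
Unshelve. all: end_near. Qed.

Lemma norm_lin_cos_sin (x y t : R) : `|x * cos t - y * sin t| <= `|x| + `|y|.
Proof.
rewrite (le_trans (ler_normB _ _))// !normrM lerD//.
  by rewrite ler_piMr// cos_max.
by rewrite ler_piMr// sin_max.
Qed.

Lemma Rintegral_expRN_cos (d x : R) : 0 < d ->
  \int[mu]_(u in I) (expR (- d * u) * cos (u * x)) = d / (d ^+ 2 + x ^+ 2).
Proof.
move=> d0; have h : d ^+ 2 + x ^+ 2 != 0 by rewrite gt_eqF// sqrD_gt0.
(* The primitive is the real part of e^{(i x - d) u} / (i x - d). *)
pose F u := expR (- d * u) *
  ((x * sin (u * x) - d * cos (u * x)) / (d ^+ 2 + x ^+ 2)).
transitivity (0 - F 0); last first.
  by rewrite /F mulr0 mul0r sin0 cos0 expR0; field.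
apply: Rintegral_FTC2y; rewrite /F.
- by move=> u _; apply: is_derive_eq; rewrite /GRing.scale/=; field.
- by move=> u _; apply: derivable_continuous_at; exact: ex_derive.
- apply: (@le_integrableR _ _ R mu I _ (fun u => expR (- d * u))) => //.
  + apply: measurable_funTS; apply: derivable_measurable_fun => u.
    exact: ex_derive.
  + by move=> u _; rewrite normrM ger0_norm ?expR_ge0// ler_piMr ?expR_ge0// cos_max.
  + exact: integrable_expRN.
- apply: (cvgy_bounded_mul (M := (`|d| + `|x|) / (d ^+ 2 + x ^+ 2))).
  + move=> u; rewrite normrM normfV [X in _ / X]gtr0_norm ?sqrD_gt0//.
    by rewrite ler_pM2r ?invr_gt0 ?sqrD_gt0// distrC norm_lin_cos_sin.
  + exact: cvgy_expRN.
Qed.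

(* The real part of [e^{i u y} / (b - i u)^2]. *)
Definition kernel_ft (b u y : R) : R :=
  ((b ^+ 2 - u ^+ 2) * cos (u * y) - 2 * b * u * sin (u * y)) /
  (b ^+ 2 + u ^+ 2) ^+ 2.

Lemma Rintegral_id_expRN_cos (b u y : R) : 0 < b ->
  \int[mu]_(v in I) (v * expR (- b * v) * cos (u * (y + v))) = kernel_ft b u y.
Proof.
move=> b0; have h : b ^+ 2 + u ^+ 2 != 0 by rewrite gt_eqF// sqrD_gt0.
set m := b ^+ 2 + u ^+ 2.
(* With s = b - i u, this is the real part of - e^{i u y} e^{- s v} (v / s + 1 / s^2), a primitive
   obtained by integrating v e^{- s v} by parts; here 1 / s = (b + i u) / m. *)
pose F v := - (v * expR (- b * v) *
    (b / m * cos (u * (y + v)) - u / m * sin (u * (y + v))))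
  - (expR (- b * v) * ((b ^+ 2 - u ^+ 2) / m ^+ 2 * cos (u * (y + v))
    - 2 * b * u / m ^+ 2 * sin (u * (y + v)))).
transitivity (0 - F 0); last first.
  by rewrite /F /kernel_ft -/m mul0r mulr0 expR0 addr0; field.
apply: Rintegral_FTC2y; rewrite /F.
- move=> v _; apply: is_derive_eq; rewrite /GRing.scale/= /m.
  by field.
- by move=> v _; apply: derivable_continuous_at; exact: ex_derive.
- apply: (@le_integrableR _ _ R mu I _ (fun v => v * expR (- b * v))) => //.
  + apply: measurable_funTS; apply: derivable_measurable_fun => v.
    exact: ex_derive.
  + move=> v; rewrite /I/= in_itv/= andbT => v0.
    rewrite normrM ger0_norm ?mulr_ge0 ?expR_ge0//.
    by rewrite ler_piMr ?mulr_ge0 ?expR_ge0// cos_max.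
  + exact: integrable_id_expRN.
- rewrite -[X in _ --> X](subrr 0) -[X in _ --> X - _]oppr0 /F; apply: cvgB.
    apply: cvgN; apply: (cvgy_bounded_mul (M := `|b / m| + `|u / m|)).
      by move=> v; exact: norm_lin_cos_sin.
    exact: cvgy_id_expRN.
  apply: (cvgy_bounded_mul (M := `|(b ^+ 2 - u ^+ 2) / m ^+ 2| + `|2 * b * u / m ^+ 2|)).
    by move=> v; exact: norm_lin_cos_sin.
  exact: cvgy_expRN.
Qed.

Lemma norm_kernel_ft (b u y : R) : 0 < b ->
  `|kernel_ft b u y| <= (b ^+ 2 + u ^+ 2)^-1.
Proof.
move=> b0; have m0 := sqrD_gt0 u b0.
rewrite /kernel_ft normrM normfV [X in _ / X]ger0_norm ?sqr_ge0//.
rewrite ler_pdivrMr ?exprn_gt0// expr2 mulKf ?gt_eqF//.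
rewrite -(@ler_pXn2r _ 2)// ?nnegrE// ?(ltW m0)//.
rewrite real_normK ?num_real//.
have := cos2Dsin2 (u * y); set c := cos _; set s := sin _ => cs.
have -> : (b ^+ 2 + u ^+ 2) ^+ 2 =
    ((b ^+ 2 - u ^+ 2) ^+ 2 + (2 * b * u) ^+ 2) * (c ^+ 2 + s ^+ 2).
  by rewrite cs; ring.
rewrite -subr_ge0.
(* Lagrange's identity, so that the bound is the Cauchy-Schwarz inequality. *)
have -> : forall X Y : R, (X ^+ 2 + Y ^+ 2) * (c ^+ 2 + s ^+ 2) - (X * c - Y * s) ^+ 2 = (X * s + Y * c) ^+ 2.
  by move=> X Y; ring.
exact: sqr_ge0.
Qed.

End half_line.

(** * Inversion of the kernel by Abel summation *)

Section inversion.
Context {R : realType}.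
Let mu := @lebesgue_measure R.
Let I : set R := `[0, +oo[%classic.

Let mI : measurable I. Proof. exact: measurable_itv. Qed.

(** The factor e^{- d u} makes Fubini's theorem applicable, and the integral in u becomes the
    Poisson kernel. Integration by parts replaces that kernel, which concentrates as d tends to 0,
    by a bounded arctangent. *)
Lemma Rintegral_poisson_kernel (b d y : R) : 0 < b -> 0 < d ->
  \int[mu]_(u in I) (expR (- d * u) * kernel_ft b u y) =
  - \int[mu]_(v in I) ((1 - b * v) * expR (- b * v) * atan ((y + v) / d)).
Proof.
move=> b0 d0.
transitivity (\int[mu]_(v in I) (v * expR (- b * v) * (d / (d ^+ 2 + (y + v) ^+ 2)))).
  transitivity (\int[mu]_(u in I) \int[mu]_(v in I)
      (expR (- d * u) * (v * expR (- b * v) * cos (u * (y + v))))).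
    apply: eq_Rintegral => u _; rewrite RintegralZl//.
      by rewrite Rintegral_id_expRN_cos.
    apply: (@le_integrableR _ _ R mu I _ (fun v => v * expR (- b * v))) => //.
    - apply: measurable_funTS; apply: derivable_measurable_fun => v.
      exact: ex_derive.
    - move=> v; rewrite /I/= in_itv/= andbT => v0.
      rewrite normrM ger0_norm ?mulr_ge0 ?expR_ge0//.
      by rewrite ler_piMr ?mulr_ge0 ?expR_ge0// cos_max.
    - exact: integrable_id_expRN.
  rewrite (@Rintegral_fubini _ _ _ _ R (@lebesgue_measure R)
    (@lebesgue_measure R) I I _ (fun u => expR (- d * u))
    (fun v => v * expR (- b * v)) mI mI).
  - apply: eq_Rintegral => v _.
    rewrite -(Rintegral_expRN_cos (y + v) d0) -RintegralZl//.
      by apply: eq_Rintegral => u _; ring.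
    apply: (@le_integrableR _ _ R mu I _ (fun u => expR (- d * u))) => //.
    + apply: measurable_funTS; apply: derivable_measurable_fun => u.
      exact: ex_derive.
    + move=> u _; rewrite normrM ger0_norm ?expR_ge0//.
      by rewrite ler_piMr ?expR_ge0// cos_max.
    + exact: integrable_expRN.
  - apply: measurable_funM.
      apply: (@measurableT_comp _ _ _ _ _ _ expR) => //.
      exact: measurable_funM.
    apply: measurable_funM.
      apply: measurable_funM => //.
      apply: (@measurableT_comp _ _ _ _ _ _ expR) => //.
      exact: measurable_funM.
    apply: (@measurableT_comp _ _ _ _ _ _ cos) => //.
      by apply: continuous_measurable_fun; exact: continuous_cos.
    by apply: measurable_funM => //; exact: measurable_funD.
  - exact: integrable_expRN.
  - exact: integrable_id_expRN.
  - move=> u v _; rewrite /I/= in_itv/= andbT => v0.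
    rewrite normrM ger0_norm ?expR_ge0// ler_wpM2l ?expR_ge0//.
    rewrite normrM ger0_norm ?mulr_ge0 ?expR_ge0//.
    by rewrite ler_piMr ?mulr_ge0 ?expR_ge0// cos_max.
have pi20 : 0 < pi / 2 :> R by rewrite divr_gt0 ?pi_gt0.
have atan_bound z : `|atan z| <= pi / 2 :> R.
  by rewrite ler_norml ltW ?atan_gtNpi2// ltW// atan_ltpi2.
have i1 : mu.-integrable I (EFin \o
    (fun v => v * expR (- b * v) * (d / (d ^+ 2 + (y + v) ^+ 2)))).
  apply: (@le_integrableR _ _ R mu I _ (fun v => d^-1 * (v * expR (- b * v)))) => //.
  - apply: measurable_funTS; apply: derivable_measurable_fun => v.
    have h : d ^+ 2 + (y + v) ^+ 2 != 0 by rewrite gt_eqF// sqrD_gt0.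
    exact: ex_derive.
  - move=> v; rewrite /I/= in_itv/= andbT => v0.
    rewrite normrM ger0_norm ?mulr_ge0 ?expR_ge0// mulrC.
    apply: ler_wpM2r; first by rewrite mulr_ge0 ?expR_ge0.
    rewrite ger0_norm ?divr_ge0 ?(ltW d0) ?(ltW (sqrD_gt0 _ d0))//.
    rewrite ler_pdivrMr ?sqrD_gt0// ler_pdivlMl//.
    by rewrite -expr2 lerDl sqr_ge0.
  - by apply: integrable_mull => //; exact: integrable_id_expRN.
have i2 : mu.-integrable I (EFin \o
    (fun v => (1 - b * v) * expR (- b * v) * atan ((y + v) / d))).
  apply: (@le_integrableR _ _ R mu I _
    (fun v => pi / 2 * expR (- b * v) + pi / 2 * b * (v * expR (- b * v)))) => //.
  - apply: measurable_funTS; apply: derivable_measurable_fun => v.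
    exact: ex_derive.
  - move=> v; rewrite /I/= in_itv/= andbT => v0.
    rewrite !normrM (ger0_norm (expR_ge0 _)).
    rewrite [leRHS](_ : _ = (1 + b * v) * expR (- b * v) * (pi / 2)); last by ring.
    apply: ler_pM => //.
    rewrite ler_wpM2r ?expR_ge0// (le_trans (ler_normB _ _))//.
    by rewrite normr1 lerD2l ger0_norm// mulr_ge0// ltW.
  - apply: integrable_add => //.
      by apply: integrable_mull => //; exact: integrable_expRN.
    by apply: integrable_mull => //; exact: integrable_id_expRN.
(* Integration by parts: v e^{- b v} atan((y + v) / d) vanishes at 0 and at infinity, so its
   derivative has integral 0. *)
have : \int[mu]_(v in I) ((1 - b * v) * expR (- b * v) * atan ((y + v) / d) +
    v * expR (- b * v) * (d / (d ^+ 2 + (y + v) ^+ 2))) = 0.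
  transitivity (0 - 0 * expR (- b * 0) * atan ((y + 0) / d)); last first.
    by rewrite !mul0r subr0.
  apply: (@Rintegral_FTC2y _ _ (fun v => v * expR (- b * v) * atan ((y + v) / d))).
  - move=> v _.
    have h : d ^+ 2 + (y + v) ^+ 2 != 0 by rewrite gt_eqF// sqrD_gt0.
    apply: is_derive_eq; rewrite /GRing.scale/=; field.
    rewrite h gt_eqF//= addrC; have := h; rewrite addrC => ->//.
  - move=> v _.
    have h : d ^+ 2 + (y + v) ^+ 2 != 0 by rewrite gt_eqF// sqrD_gt0.
    by apply: derivable_continuous_at; exact: ex_derive.
  - exact: integrable_add.
  - apply: (cvgy_bounded_mul (M := pi / 2)) => //.
    exact: cvgy_id_expRN.
rewrite RintegralD// => /eqP; rewrite addrC addr_eq0 => /eqP //.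
Qed.

Lemma cvg_atan_harm (z : R) :
  atan (z / n.+1%:R^-1) @[n --> \oo] --> pi / 2 * Num.sg z.
Proof.
have pos (w : R) : 0 < w -> atan (w / n.+1%:R^-1) @[n --> \oo] --> pi / 2.
  move=> w0; have h : w / n.+1%:R^-1 @[n --> \oo] --> +oo.
    apply/cvgryPge => r; near=> n.
    rewrite invrK -ler_pdivrMl// (@le_trans _ _ n%:R)//; last by rewrite ler_nat.
    by near: n; exact: nbhs_infty_ger.
  exact: (cvg_comp _ _ h (@cvgy_atan R)).
have [z0|z0|->] := ltgtP z 0.
- rewrite ltr0_sg// mulrN1.
  rewrite (_ : (fun n => _) = (fun n => - atan (- z / n.+1%:R^-1))); last first.
    by apply/funext => n; rewrite mulNr atanN opprK.
  by apply: cvgN; apply: pos; rewrite oppr_gt0.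
- by rewrite gtr0_sg// mulr1; exact: pos.
- rewrite sgr0 mulr0; under eq_fun do rewrite mul0r atan0.
  exact: cvg_cst.
Unshelve. all: end_near. Qed.

(** The function (1 - b v) e^{- b v} is the derivative of v e^{- b v} and has total integral 0.
    Changing its sign below s = - y therefore leaves -2 s e^{- b s} when s > 0, and 0 otherwise. *)
Lemma Rintegral_expRN_sg (b y : R) : 0 < b ->
  mu.-integrable I (EFin \o (fun v =>
    (1 - b * v) * expR (- b * v) * (pi / 2 * Num.sg (y + v)))) ->
  \int[mu]_(v in I) ((1 - b * v) * expR (- b * v) * (pi / 2 * Num.sg (y + v))) =
  - (pi * (Num.max (- y) 0 * expR (b * y))).
Proof.
move=> b0 intsg.
pose f v := (1 - b * v) * expR (- b * v).
have intf : mu.-integrable I (EFin \o f).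
  apply: (@le_integrableR _ _ R mu I _
    (fun v => expR (- b * v) + b * (v * expR (- b * v)))) => //.
  - apply: measurable_funTS; apply: derivable_measurable_fun => v.
    exact: ex_derive.
  - move=> v; rewrite /I/= in_itv/= andbT => v0.
    rewrite /f normrM (ger0_norm (expR_ge0 _)).
    rewrite [leRHS](_ : _ = (1 + b * v) * expR (- b * v)); last by ring.
    rewrite ler_wpM2r ?expR_ge0// (le_trans (ler_normB _ _))//.
    by rewrite normr1 lerD2l ger0_norm// mulr_ge0// ltW.
  - apply: integrable_add => //; first exact: integrable_expRN.
    by apply: integrable_mull => //; exact: integrable_id_expRN.
have df (v : R) : is_derive v (1 : R) (fun v => v * expR (- b * v)) (f v).
  by apply: is_derive_eq; rewrite /GRing.scale/= /f; ring.
have cf (v : R) : {for v, continuous f}.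
  by apply: derivable_continuous_at; rewrite /f; exact: ex_derive.
have If : \int[mu]_(v in I) f v = 0.
  transitivity (0 - 0 * expR (- b * 0)); last by rewrite mul0r subr0.
  apply: (@Rintegral_FTC2y _ _ (fun v => v * expR (- b * v))) => //.
  exact: cvgy_id_expRN.
have Ifs s : 0 <= s -> \int[mu]_(v in `[0, s]) f v = s * expR (- b * s).
  move=> s0; transitivity (s * expR (- b * s) - 0 * expR (- b * 0)); last first.
    by rewrite mul0r subr0.
  apply: (@Rintegral_FTC2 _ _ (fun v => v * expR (- b * v))) => //.
  by apply: continuous_subspaceT => v; exact: cf.
have [y0|y0] := lerP 0 y.
  rewrite max_r ?oppr_le0// mul0r mulr0 oppr0.
  (* The sign is 1 except at v = 0 when y = 0; the endpoint is removed from both integrals. *)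
  rewrite -[RHS](mulr0 (pi / 2)) -[in RHS]If -RintegralZl// -[LHS]Rintegral_itv_obnd_cbnd; last first.
    apply: integrableS intsg => //.
    by apply: subset_itvr; rewrite bnd_simp.
  rewrite -[RHS]Rintegral_itv_obnd_cbnd; last first.
    have intf2 : mu.-integrable I (EFin \o (fun v => pi / 2 * f v)).
      exact: integrable_mull.
    apply: integrableS intf2 => //.
    by apply: subset_itvr; rewrite bnd_simp.
  apply: eq_Rintegral => v; rewrite inE/= in_itv/= andbT => v0.
  by rewrite gtr0_sg ?mulr1; [rewrite mulrC|rewrite ltr_wpDl].
rewrite max_l ?oppr_ge0 ?(ltW y0)//.
have s0 : 0 <= - y by rewrite oppr_ge0 ltW.
(* On v >= 0 the sign of v - s is 1 minus the indicators of [0, s[ and of [0, s], which is also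
   correct at v = s. *)
transitivity (\int[mu]_(v in I) (pi / 2 * (f v - (f \_ `[0, - y[) v - (f \_ `[0, - y]) v))).
  apply: eq_Rintegral => v; rewrite inE /I/= in_itv/= andbT => v0.
  rewrite !patchE !mem_setE !in_itv/= v0/= -/(f v) (_ : point = 0 :> R)//.
  have [h|h|h] := ltgtP v (- y).
  - by rewrite ltr0_sg; [ring|rewrite -ltrBrDl sub0r].
  - by rewrite gtr0_sg; [ring|rewrite -ltrBlDl sub0r].
  - by rewrite h subrr sgr0; ring.
have ifo : mu.-integrable I (EFin \o (f \_ `[0, - y[)).
  rewrite -restrict_EFin; apply/integrable_restrict => //.
  by apply: integrableS intf => //; exact: measurableI.
have ifc : mu.-integrable I (EFin \o (f \_ `[0, - y])).
  rewrite -restrict_EFin; apply/integrable_restrict => //.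
  by apply: integrableS intf => //; exact: measurableI.
rewrite RintegralZl ?RintegralB//; last 2 first.
- exact: integrable_sub.
- by apply: integrable_sub => //; exact: integrable_sub.
rewrite If sub0r -!Rintegral_mkcondr.
rewrite !setIidr; last 2 first.
  by apply: subset_itvl.
  by apply: subset_itvl.
rewrite Rintegral_itv_bndo_bndc ?Ifs//; last first.
  apply: integrableS intf => //.
  by apply: subset_itvl.
by rewrite mulrNN; field.
Qed.

(** Both sides of the Poisson identity converge by dominated convergence along d = 1 / (n + 1): the
    factor e^{- d u} tends to 1 and the arctangent to pi / 2 times a sign. *)
Lemma kernel_inversion (b y : R) : 0 < b ->
  \int[mu]_(u in I) kernel_ft b u y = pi * (Num.max (- y) 0 * expR (b * y)).
Proof.
move=> b0.
have [||||_ c1] := @cvg_Rintegral_dominated _ _ _ mu I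
  (fun n u => expR (- n.+1%:R^-1 * u) * kernel_ft b u y)
  (fun u => kernel_ft b u y) (fun u => (b ^+ 2 + u ^+ 2)^-1) mI.
- move=> n; apply: measurable_funTS; apply: derivable_measurable_fun => u.
  have h : (b ^+ 2 + u ^+ 2) ^+ 2 != 0 by rewrite expf_neq0// gt_eqF// sqrD_gt0.
  exact: ex_derive.
- move=> u _; rewrite -[X in _ --> X]mul1r; apply: cvgM; last exact: cvg_cst.
  have : expR (- n.+1%:R^-1 * u) @[n --> \oo] --> expR (- 0 * u).
    apply: continuous_cvg; first exact: continuous_expR.
    by apply: cvgM; [apply: cvgN; exact: cvg_harmonic|exact: cvg_cst].
  by rewrite oppr0 mul0r expR0.
- exact: integrable_invsqrD.
- move=> n u; rewrite /I/= in_itv/= andbT => u0.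
  rewrite normrM ger0_norm ?expR_ge0// -[leRHS]mul1r ler_pM ?expR_ge0//.
    by rewrite -expR0 ler_expR mulNr oppr_le0 mulr_ge0// ltW.
  exact: norm_kernel_ft.
have [||||i2 c2] := @cvg_Rintegral_dominated _ _ _ mu I
  (fun n v => (1 - b * v) * expR (- b * v) * atan ((y + v) / n.+1%:R^-1))
  (fun v => (1 - b * v) * expR (- b * v) * (pi / 2 * Num.sg (y + v)))
  (fun v => pi / 2 * expR (- b * v) + pi / 2 * b * (v * expR (- b * v))) mI.
- move=> n; apply: measurable_funTS; apply: derivable_measurable_fun => u.
  exact: ex_derive.
- by move=> v _; apply: cvgM; [exact: cvg_cst|exact: cvg_atan_harm].
- apply: integrable_add => //.
    by apply: integrable_mull => //; exact: integrable_expRN.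
  by apply: integrable_mull => //; exact: integrable_id_expRN.
- move=> n v; rewrite /I/= in_itv/= andbT => v0.
  rewrite !normrM (ger0_norm (expR_ge0 _)).
  rewrite [leRHS](_ : _ = (1 + b * v) * expR (- b * v) * (pi / 2)); last by ring.
  apply: ler_pM => //.
    rewrite ler_wpM2r ?expR_ge0// (le_trans (ler_normB _ _))//.
    by rewrite normr1 lerD2l ger0_norm// mulr_ge0// ltW.
  by rewrite ler_norml ltW ?atan_gtNpi2// ltW// atan_ltpi2.
have E : (fun n => \int[mu]_(u in I) (expR (- n.+1%:R^-1 * u) * kernel_ft b u y)) =
    (fun n => - \int[mu]_(v in I)
      ((1 - b * v) * expR (- b * v) * atan ((y + v) / n.+1%:R^-1))).
  by apply/funext => n; rewrite -Rintegral_poisson_kernel.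
rewrite E in c1.
rewrite (cvg_unique _ c1 (cvgN c2))//.
by rewrite Rintegral_expRN_sg// opprK.
Qed.

End inversion.

(** * Rotation of the contour *)

Section rotation.
Context {R : realType}.
Let mu := @lebesgue_measure R.
Variables (lam al th kap b : R).
Hypotheses (lam0 : 0 < lam) (al0 : 0 < al) (kap01 : 0 <= kap <= 1) (b0 : 0 < b).

(* At [u = r e^{- i be}], [1 + lam u^al e^{- i th}] is [Dre - i Dim] and
   [b + i u] is [Ere + i Eim]; [kap] stands for [1 / k]. *)
Definition rho (r : R) : R := lam * r `^ al.
Definition Dre (r g : R) : R := 1 + rho r * cos g.
Definition Dim (r g : R) : R := rho r * sin g.
Definition Ere (r be : R) : R := b + r * sin be.
Definition Eim (r be : R) : R := r * cos be.
Definition lnD (r be : R) : R := ln (Dre r (al * be + th) ^+ 2 + Dim r (al * be + th) ^+ 2).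
Definition argD (r be : R) : R := carg (Dre r (al * be + th)) (Dim r (al * be + th)).
Definition lnE (r be : R) : R := ln (Ere r be ^+ 2 + Eim r be ^+ 2).
Definition argE (r be : R) : R := carg (Ere r be) (Eim r be).

(** [logmod] and [phase] are the log-modulus and an argument of e^{- i t u} D^{- kap} (b + i u)^{-2}
    e^{- i be} at u = r e^{- i be}, with D = [Dre] - i [Dim]. Since [lnD] and [lnE] are logarithms
    of squared moduli, halves appear. [rotf] is the real part of this function and [rotg] is r times
    its imaginary part. *)
Definition logmod (t r be : R) : R := - t * r * sin be - kap / 2 * lnD r be - lnE r be.
Definition phase (t r be : R) : R := - t * r * cos be + kap * argD r be - 2 * argE r be - be.
Definition rotf (t r be : R) : R := expR (logmod t r be) * cos (phase t r be).
Definition rotg (t r be : R) : R := r * expR (logmod t r be) * sin (phase t r be).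

(** The derivatives of [logmod], [phase] and [rotf] with respect to [be]. *)
Definition dlogmod (t r be : R) : R := - t * r * cos be
  + kap * al * rho r * sin (al * be + th) /
    (Dre r (al * be + th) ^+ 2 + Dim r (al * be + th) ^+ 2)
  - 2 * b * r * cos be / (Ere r be ^+ 2 + Eim r be ^+ 2).
Definition dphase (t r be : R) : R := t * r * sin be
  + kap * al * rho r * (cos (al * be + th) + rho r) /
    (Dre r (al * be + th) ^+ 2 + Dim r (al * be + th) ^+ 2)
  + 2 * (b * r * sin be + r ^+ 2) / (Ere r be ^+ 2 + Eim r be ^+ 2) - 1.
Definition drotf (t r be : R) : R := expR (logmod t r be) *
  (dlogmod t r be * cos (phase t r be) - dphase t r be * sin (phase t r be)).

Lemma rho_gt0 (r : R) : 0 < r -> 0 < rho r.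
Proof. by move=> r0; rewrite mulr_gt0// powR_gt0. Qed.

Lemma is_derive_rho (r : R) : 0 < r -> is_derive r 1 rho (al * rho r / r).
Proof.
move=> r0; have h := is_derive1_powR al r0.
have h2 := is_deriveZ lam h.
apply: (is_derive_eq h2); rewrite /GRing.scale/= /rho.
rewrite powRB; last by rewrite (@gt_eqF _ _ r)// implybT.
rewrite powRr1 ?ltW//.
by field; rewrite gt_eqF.
Qed.

Section point.
Variables (t r be : R).
Hypotheses (r0 : 0 < r) (cg : -1 < cos (al * be + th)) (Er : 0 < Ere r be).

(** If the imaginary part vanishes, the cosine is 1 or -1. The value -1 is excluded, and for 1 the
    real part is 1 + rho > 0. *)
Lemma slitD : 0 < cabs (Dre r (al * be + th)) (Dim r (al * be + th)) + Dre r (al * be + th).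
Proof.
have [s0|s0] := eqVneq (sin (al * be + th)) 0.
  apply: slit_pos.
  have := cos2Dsin2 (al * be + th); rewrite s0 expr0n addr0 => /eqP.
  rewrite sqrf_eq1 => /orP[/eqP c1|/eqP c1].
    by rewrite /Dre c1 mulr1 ltr_wpDr// ltW// rho_gt0.
  by move: cg; rewrite c1 ltxx.
by apply: slit_im; rewrite mulf_neq0// gt_eqF// rho_gt0.
Qed.

Lemma sqnD_gt0 : 0 < Dre r (al * be + th) ^+ 2 + Dim r (al * be + th) ^+ 2.
Proof. by rewrite -cabs_sqr exprn_gt0// cabs_gt0// slitD. Qed.

Lemma slitE : 0 < cabs (Ere r be) (Eim r be) + Ere r be.
Proof. exact: slit_pos. Qed.

Lemma sqnE_gt0 : 0 < Ere r be ^+ 2 + Eim r be ^+ 2.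
Proof. by rewrite -cabs_sqr exprn_gt0// cabs_gt0// slitE. Qed.

Lemma sqnDE : Dre r (al * be + th) ^+ 2 + Dim r (al * be + th) ^+ 2 =
  1 + 2 * rho r * cos (al * be + th) + rho r ^+ 2.
Proof.
have h : sin (al * be + th) ^+ 2 = 1 - cos (al * be + th) ^+ 2.
  by rewrite -(cos2Dsin2 (al * be + th)); ring.
by rewrite /Dre /Dim; ring: h.
Qed.

Lemma sqnEE : Ere r be ^+ 2 + Eim r be ^+ 2 = b ^+ 2 + 2 * b * r * sin be + r ^+ 2.
Proof.
have h : sin be ^+ 2 = 1 - cos be ^+ 2 by rewrite -(cos2Dsin2 be); ring.
by rewrite /Ere /Eim; ring: h.
Qed.

Lemma is_derive_rotf : is_derive be 1 (rotf t r) (drotf t r be).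
Proof.
have hX : is_derive be 1 (fun be => Dre r (al * be + th)) (- (al * Dim r (al * be + th))).
  by apply: is_derive_eq; rewrite /GRing.scale/= /Dim; ring.
have hY : is_derive be 1 (fun be => Dim r (al * be + th)) (al * (rho r * cos (al * be + th))).
  by apply: is_derive_eq; rewrite /GRing.scale/=; ring.
have hU : is_derive be 1 (Ere r) (r * cos be).
  by apply: is_derive_eq; rewrite /GRing.scale/=; ring.
have hV : is_derive be 1 (Eim r) (- (r * sin be)).
  by apply: is_derive_eq; rewrite /GRing.scale/=; ring.
have SD := sqnD_gt0; have SE := sqnE_gt0.
have h1 : is_derive be 1 (lnD r) _ := is_derive_ln_sqn hX hY (cabs_gt0 slitD).
have h2 : is_derive be 1 (argD r) _ := is_derive_carg hX hY slitD.
have h3 : is_derive be 1 (lnE r) _ := is_derive_ln_sqn hU hV (cabs_gt0 slitE).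
have h4 : is_derive be 1 (argE r) _ := is_derive_carg hU hV slitE.
have hp : is_derive be 1 (logmod t r) (dlogmod t r be).
  apply: is_derive_eq; rewrite /GRing.scale/= /dlogmod.
  have := lt0r_neq0 SD; have := lt0r_neq0 SE => nE nD.
  set SD' := Dre _ _ ^+ 2 + _ in nD *; set SE' := Ere _ _ ^+ 2 + _ in nE *.
  rewrite /Dre /Dim /Ere /Eim; field.
  by rewrite nD nE.
have hq : is_derive be 1 (phase t r) (dphase t r be).
  apply: is_derive_eq; rewrite /GRing.scale/= /dphase.
  have := lt0r_neq0 SD; have := lt0r_neq0 SE => nE nD.
  have cs1 := cos2Dsin2 (al * be + th); have cs2 := cos2Dsin2 be.
  have cs1' : sin (al * be + th) ^+ 2 = 1 - cos (al * be + th) ^+ 2 by rewrite -cs1; ring.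
  have cs2' : sin be ^+ 2 = 1 - cos be ^+ 2 by rewrite -cs2; ring.
  (* The squared moduli are kept as atoms in the denominators; the numerators are reduced by sin^2 +
     cos^2 = 1. *)
  set SD' := Dre _ _ ^+ 2 + _ in nD *; set SE' := Ere _ _ ^+ 2 + _ in nE *.
  rewrite /Dre /Dim /Ere /Eim; field: cs1' cs2'.
  by rewrite nD nE.
apply: is_derive_eq; rewrite /GRing.scale/= /drotf; ring.
Qed.

(** The Cauchy-Riemann equations in polar form. The 1 added to [dphase] discards the term - be of
    [phase], which comes from du and does not depend on r. *)
Lemma is_derive_logmod_phase :
  is_derive r 1 (fun r => logmod t r be) (- (dphase t r be + 1) / r) /\
  is_derive r 1 (fun r => phase t r be) (dlogmod t r be / r).
Proof.
have hr := is_derive_rho r0.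
have nr : r != 0 by rewrite gt_eqF.
have hX : is_derive r 1 (fun r => Dre r (al * be + th)) (al * rho r / r * cos (al * be + th)).
  by apply: is_derive_eq; rewrite /GRing.scale/=; ring.
have hY : is_derive r 1 (fun r => Dim r (al * be + th)) (al * rho r / r * sin (al * be + th)).
  by apply: is_derive_eq; rewrite /GRing.scale/=; ring.
have hU : is_derive r 1 (fun r => Ere r be) (sin be).
  by apply: is_derive_eq; rewrite /GRing.scale/=; ring.
have hV : is_derive r 1 (fun r => Eim r be) (cos be).
  by apply: is_derive_eq; rewrite /GRing.scale/=; ring.
have SD := sqnD_gt0; have SE := sqnE_gt0.
have h1 : is_derive r 1 (fun r => lnD r be) _ := is_derive_ln_sqn hX hY (cabs_gt0 slitD).
have h2 : is_derive r 1 (fun r => argD r be) _ := is_derive_carg hX hY slitD.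
have h3 : is_derive r 1 (fun r => lnE r be) _ := is_derive_ln_sqn hU hV (cabs_gt0 slitE).
have h4 : is_derive r 1 (fun r => argE r be) _ := is_derive_carg hU hV slitE.
have := lt0r_neq0 SD; have := lt0r_neq0 SE => nE nD.
have cs1 := cos2Dsin2 (al * be + th); have cs2 := cos2Dsin2 be.
have cs1' : sin (al * be + th) ^+ 2 = 1 - cos (al * be + th) ^+ 2 by rewrite -cs1; ring.
have cs2' : sin be ^+ 2 = 1 - cos be ^+ 2 by rewrite -cs2; ring.
split.
  apply: is_derive_eq; rewrite /GRing.scale/= /dphase.
  set SD' := Dre _ _ ^+ 2 + _ in nD *; set SE' := Ere _ _ ^+ 2 + _ in nE *.
  rewrite /Dre /Dim /Ere /Eim; field: cs1' cs2'.
  by rewrite nD nE nr.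
apply: is_derive_eq; rewrite /GRing.scale/= /dlogmod.
set SD' := Dre _ _ ^+ 2 + _ in nD *; set SE' := Ere _ _ ^+ 2 + _ in nE *.
rewrite /Dre /Dim /Ere /Eim; field: cs1' cs2'.
by rewrite nD nE nr.
Qed.

(** The r-derivative of [rotg] equals the be-derivative of [rotf]: the derivative of the factor r
    supplies the sine that cancels the added 1. This identity makes the contour rotation work. *)
Lemma is_derive_rotg : is_derive r 1 (fun r => rotg t r be) (drotf t r be).
Proof.
have [hp hq] := is_derive_logmod_phase.
have nr : r != 0 by rewrite gt_eqF.
apply: is_derive_eq; rewrite /GRing.scale/= /drotf; field.
exact: nr.
Qed.

Lemma derivable_rotf : derivable (fun r => rotf t r be) r 1.
Proof.
have [hp hq] := is_derive_logmod_phase.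
exact: ex_derive.
Qed.

Lemma continuous_drotf : {for r, continuous (fun r => drotf t r be)}.
Proof.
apply: derivable_continuous_at.
have [hp hq] := is_derive_logmod_phase.
have hr := is_derive_rho r0.
have SD := lt0r_neq0 sqnD_gt0; have SE := lt0r_neq0 sqnE_gt0.
have hX : is_derive r 1 (fun r => Dre r (al * be + th)) (al * rho r / r * cos (al * be + th)).
  by apply: is_derive_eq; rewrite /GRing.scale/=; ring.
have hY : is_derive r 1 (fun r => Dim r (al * be + th)) (al * rho r / r * sin (al * be + th)).
  by apply: is_derive_eq; rewrite /GRing.scale/=; ring.
have hU : is_derive r 1 (fun r => Ere r be) (sin be).
  by apply: is_derive_eq; rewrite /GRing.scale/=; ring.
have hV : is_derive r 1 (fun r => Eim r be) (cos be).
  by apply: is_derive_eq; rewrite /GRing.scale/=; ring.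
rewrite /drotf /dlogmod /dphase; exact: ex_derive.
Qed.

End point.
End rotation.

Section quadrant.
Context {R : realType}.

Lemma cos_sin_quadrant (be : R) : 0 <= be <= pi / 2 -> 0 <= cos be /\ 0 <= sin be.
Proof.
move=> /andP[be0 be1]; have p0 := pi_gt0 R; split.
  by apply: cos_ge0_pihalf; rewrite be1 andbT; lra.
by apply: sin_ge0_pi; rewrite be0/=; lra.
Qed.

(* A parametrization of the quarter turn by the whole line, so that no
   one-sided derivatives are needed at its ends. *)
Definition quarter (s : R) : R := pi / 4 * (1 - cos s).

Lemma quarter_itv s : 0 <= quarter s <= pi / 2.
Proof.
have p0 := pi_gt0 R; have := cos_le1 s; have := cos_geN1 s => c1 c2.
rewrite /quarter mulr_ge0 ?divr_ge0 ?subr_ge0 ?(ltW p0)//=.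
have -> : pi / 2 = pi / 4 * 2 :> R by field.
by rewrite ler_wpM2l ?divr_ge0 ?(ltW p0)//; lra.
Qed.

End quadrant.

Lemma measurable_rotf {R : realType} (lam al th kap b t : R) :
  0 < lam -> 0 < b -> -1 < cos th ->
  measurable_fun (`]0, +oo[ : set R) (rotf lam al th kap b t ^~ 0).
Proof.
move=> lam0 b0 cth.
apply: open_continuous_measurable_fun; first exact: interval_open.
move=> r; rewrite inE/= in_itv/= andbT => r0.
apply: derivable_continuous_at.
apply: derivable_rotf => //; first by rewrite mulr0 add0r.
by rewrite /Ere sin0 mulr0 addr0.
Qed.

(** * The quarter turn when the angle stays away from pi *)

Section contour.
Context {R : realType}.
Let mu := @lebesgue_measure R.
Variables (lam al th kap b c : R).
Hypotheses (lam0 : 0 < lam) (al0 : 0 < al) (kap01 : 0 <= kap <= 1) (b0 : 0 < b).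
Hypothesis c01 : 0 <= c < 1.
Hypothesis cosc : forall be, 0 <= be <= pi / 2 -> - c <= cos (al * be + th).

Local Notation rotf := (rotf lam al th kap b).
Local Notation rotg := (rotg lam al th kap b).
Local Notation drotf := (drotf lam al th kap b).
Local Notation logmod := (logmod lam al th kap b).
Local Notation rho := (rho lam al).

Let cos_gtN1 be : 0 <= be <= pi / 2 -> -1 < cos (al * be + th).
Proof. by move=> /cosc; apply: lt_le_trans; rewrite ltrN2; case/andP: c01. Qed.

Let Ere_gt0 r be : 0 < r -> 0 <= be <= pi / 2 -> 0 < Ere b r be.
Proof.
move=> r0 /cos_sin_quadrant[_ s0].
by rewrite /Ere ltr_wpDr// mulr_ge0// ltW.
Qed.

(** With cosine at least - c, the squared modulus is at least 1 - 2 c rho + rho^2 = (1 - c) + c (1 -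
    rho)^2 + (1 - c) rho^2. *)
Lemma sqnD_ge r be : 0 <= be <= pi / 2 ->
  1 - c <= Dre lam al r (al * be + th) ^+ 2 + Dim lam al r (al * be + th) ^+ 2.
Proof.
move=> hbe; rewrite sqnDE.
have r0 : 0 <= rho r by rewrite mulr_ge0 ?powR_ge0// ltW.
have h := cosc hbe; case/andP: c01 => c0 c1.
have h2 : - (c * rho r) <= rho r * cos (al * be + th).
  by rewrite -mulNr mulrC ler_wpM2l.
have : 0 <= c * (1 - rho r) ^+ 2 by rewrite mulr_ge0 ?sqr_ge0.
have : 0 <= (1 - c) * rho r ^+ 2 by rewrite mulr_ge0 ?sqr_ge0// subr_ge0 ltW.
nra.
Qed.

Lemma sqnE_ge r be : 0 < r -> 0 <= be <= pi / 2 ->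
  b ^+ 2 + r ^+ 2 <= Ere b r be ^+ 2 + Eim r be ^+ 2.
Proof.
move=> r0 /cos_sin_quadrant[_ s0].
by rewrite sqnEE addrAC lerDl !mulr_ge0// ltW.
Qed.

(** The number (1 - c)^{- kap / 2}, which bounds the modulus of D^{- kap}. *)
Definition modbound : R := expR (- (kap / 2 * ln (1 - c))).

Lemma expR_logmod_le t r be : 0 <= t -> 0 < r -> 0 <= be <= pi / 2 ->
  expR (logmod t r be) <= modbound / (b ^+ 2 + r ^+ 2).
Proof.
move=> t0 r0 hbe; have [cb sb] := cos_sin_quadrant hbe.
have hD := sqnD_ge r hbe; have hE := sqnE_ge r0 hbe.
have m0 := sqrD_gt0 r b0.
have d0 : 0 < 1 - c by rewrite subr_gt0; case/andP: c01.
rewrite /modbound -[X in _ / X]lnK ?posrE// -expRN -expRD ler_expR /logmod.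
have h1 : ln (1 - c) <= lnD lam al th r be by rewrite ler_ln ?posrE ?(lt_le_trans _ hD).
have h2 : ln (b ^+ 2 + r ^+ 2) <= lnE b r be by rewrite ler_ln ?posrE ?(lt_le_trans _ hE).
have h3 : 0 <= t * r * sin be by rewrite !mulr_ge0// ltW.
have h4 : kap / 2 * ln (1 - c) <= kap / 2 * lnD lam al th r be.
  by rewrite ler_wpM2l// divr_ge0//; case/andP: kap01.
rewrite !mulNr; lra.
Qed.

Lemma norm_rotf_le t r be : 0 <= t -> 0 < r -> 0 <= be <= pi / 2 ->
  `|rotf t r be| <= modbound / (b ^+ 2 + r ^+ 2).
Proof.
move=> t0 r0 hbe; rewrite normrM ger0_norm ?expR_ge0//.
by rewrite (le_trans _ (expR_logmod_le t0 r0 hbe))// ler_piMr ?expR_ge0// cos_max.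
Qed.

Lemma norm_rotg_le t r be : 0 <= t -> 0 < r -> 0 <= be <= pi / 2 ->
  `|rotg t r be| <= r * (modbound / (b ^+ 2 + r ^+ 2)).
Proof.
move=> t0 r0 hbe; rewrite !normrM (gtr0_norm r0) (ger0_norm (expR_ge0 _)) -mulrA.
rewrite ler_pM2l// (le_trans _ (expR_logmod_le t0 r0 hbe))//.
by rewrite ler_piMr ?expR_ge0// sin_max.
Qed.

Lemma rho_le r r1 : 0 < r <= r1 -> rho r <= rho r1.
Proof.
move=> /andP[r0 rr1]; rewrite /rho ler_pM2l//.
apply: ge0_ler_powR => //; first exact: ltW.
  by rewrite nnegrE ltW.
by rewrite nnegrE ltW// (lt_le_trans r0).
Qed.

(** A crude uniform bound, needed only to differentiate under the integral over a segment. *)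
Lemma drotf_bound t r1 : 0 <= t -> exists2 G : R, 0 <= G &
  forall r be, 0 < r <= r1 -> 0 <= be <= pi / 2 -> `|drotf t r be| <= G.
Proof.
move=> t0.
have d0 : 0 < 1 - c by rewrite subr_gt0; case/andP: c01.
case/andP: (kap01) => k0 k1.
(* [G1] and [G2] bound [dlogmod] and [dphase] term by term, with sines and cosines replaced by 1 and
   the squared moduli by their lower bounds. *)
pose G1 := t * `|r1| + kap * al * rho r1 / (1 - c) + 2 * b * `|r1| / b ^+ 2.
pose G2 := t * `|r1| + kap * al * rho r1 * (1 + rho r1) / (1 - c)
  + 2 * (b * `|r1| + `|r1| ^+ 2) / b ^+ 2 + 1.
have rho0 s : 0 <= rho s by rewrite mulr_ge0 ?powR_ge0// ltW.
have al0' := ltW al0; have b0' := ltW b0; have d0' := ltW d0.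
have bb := sqr_ge0 b; have nr1 := normr_ge0 r1.
have G10 : 0 <= G1.
  by do ?[done | apply: addr_ge0 | apply: divr_ge0 | apply: mulr_ge0].
have G20 : 0 <= G2.
  by do ?[done | apply: addr_ge0 | apply: divr_ge0 | apply: mulr_ge0
         | apply: exprn_ge0].
exists (modbound / b ^+ 2 * (G1 + G2)).
  apply: mulr_ge0; last exact: addr_ge0.
  by apply: divr_ge0 => //; exact: expR_ge0.
move=> r be /andP[r0 rr1] hbe; have [cb sb] := cos_sin_quadrant hbe.
have r10 : 0 < r1 by exact: lt_le_trans rr1.
have hD := sqnD_ge r hbe; have hE := sqnE_ge r0 hbe.
have hrho : rho r <= rho r1 by apply: rho_le; rewrite r0.
have E0 : b ^+ 2 <= Ere b r be ^+ 2 + Eim r be ^+ 2.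
  by rewrite (le_trans _ hE)// lerDl sqr_ge0.
have b20 : 0 < b ^+ 2 by rewrite exprn_gt0.
have nD : 0 <= Dre lam al r (al * be + th) ^+ 2 + Dim lam al r (al * be + th) ^+ 2.
  by rewrite addr_ge0 ?sqr_ge0.
have nE : 0 <= Ere b r be ^+ 2 + Eim r be ^+ 2 by rewrite addr_ge0 ?sqr_ge0.
have cm := cos_max be; have sm := sin_max be.
have cm' := cos_max (al * be + th); have sm' := sin_max (al * be + th).
have hr : `|r| <= `|r1| by rewrite !gtr0_norm.
have ht : `|t| <= t by rewrite ger0_norm.
have hk : `|kap| <= kap by rewrite ger0_norm.
have ha : `|al| <= al by rewrite gtr0_norm.
have hb : `|b| <= b by rewrite gtr0_norm.
have h2 : `|2 : R| <= 2 by rewrite ger0_norm.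
have hrho' : `|rho r| <= rho r1 by rewrite ger0_norm.
have hD' : `|(Dre lam al r (al * be + th) ^+ 2 + Dim lam al r (al * be + th) ^+ 2)^-1|
    <= (1 - c)^-1.
  by rewrite normfV ger0_norm// lef_pV2 ?posrE// (lt_le_trans d0).
have hE' : `|(Ere b r be ^+ 2 + Eim r be ^+ 2)^-1| <= (b ^+ 2)^-1.
  by rewrite normfV ger0_norm// lef_pV2 ?posrE// (lt_le_trans b20).
have lnm (x y X Y : R) : `|x| <= X -> `|y| <= Y -> `|x * y| <= X * Y.
  by move=> hx hy; rewrite normrM ler_pM.
have lnd (x y X Y : R) : `|x| <= X -> `|y| <= Y -> `|x + y| <= X + Y.
  by move=> hx hy; rewrite (le_trans (ler_normD _ _))// lerD.
have lnb (x y X Y : R) : `|x| <= X -> `|y| <= Y -> `|x - y| <= X + Y.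
  by move=> hx hy; rewrite (le_trans (ler_normB _ _))// lerD.
have ln1 (x y X : R) : `|x| <= X -> `|y| <= 1 -> `|x * y| <= X.
  by move=> hx hy; rewrite -[X]mulr1; exact: (lnm).
rewrite normrM (ger0_norm (expR_ge0 _)); apply: ler_pM => //.
- rewrite (le_trans (expR_logmod_le _ _ _))// ler_wpM2l ?expR_ge0//.
  by rewrite lef_pV2 ?posrE ?sqrD_gt0// lerDl sqr_ge0.
rewrite (le_trans (norm_lin_cos_sin _ _ _))//; apply: lerD.
- apply: (lnb); last by apply: (lnm) => //; apply: (ln1) => //; do 2 apply: (lnm) => //.
  apply: (lnd); first by apply: (ln1) => //; apply: (lnm) => //; rewrite normrN.
  by apply: (lnm) => //; apply: (ln1) => //; do 2 apply: (lnm) => //.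
- apply: (lnb); last by rewrite normr1.
  apply: (lnd); last first.
    apply: (lnm) => //; apply: (lnm) => //; apply: (lnd).
      by apply: (ln1) => //; exact: (lnm).
    by rewrite !normrX ler_pXn2r ?nnegrE.
  apply: (lnd); first by apply: (ln1) => //; exact: (lnm).
  by apply: (lnm) => //; apply: (lnm); [do 2 apply: (lnm) => //|exact: (lnd)].
Qed.

Lemma integrable_rotf t be r0 r1 : 0 < r0 -> 0 <= be <= pi / 2 ->
  mu.-integrable `[r0, r1] (EFin \o rotf t ^~ be).
Proof.
move=> r00 hbe; apply: continuous_compact_integrable; first exact: segment_compact.
apply: continuous_in_subspaceT => r; rewrite inE/= in_itv/= => /andP[r0r _].
have r0' : 0 < r by exact: lt_le_trans r0r.
by apply: derivable_continuous_at; apply: derivable_rotf => //; [exact: cos_gtN1|exact: Ere_gt0].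
Qed.

Lemma Rintegral_drotf t be r0 r1 : 0 < r0 <= r1 -> 0 <= be <= pi / 2 ->
  \int[mu]_(r in `[r0, r1]) drotf t r be = rotg t r1 be - rotg t r0 be.
Proof.
move=> /andP[r00 r01] hbe.
have dF r : r0 <= r <= r1 -> is_derive r 1 (fun r => rotg t r be) (drotf t r be).
  move=> /andP[r0r _]; have r0' : 0 < r by exact: lt_le_trans r0r.
  exact: (is_derive_rotg kap lam0 t r0' (cos_gtN1 hbe) (Ere_gt0 r0' hbe)).
have cf : {within `[r0, r1], continuous (fun r => drotf t r be)}.
  apply: continuous_in_subspaceT => r; rewrite inE/= in_itv/= => /andP[r0r _].
  have r0' : 0 < r by exact: lt_le_trans r0r.
  exact: (continuous_drotf lam0 r0' (cos_gtN1 hbe) (Ere_gt0 r0' hbe)).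
exact: (Rintegral_FTC2 r01 dF cf).
Qed.

(** The integral of [rotf] over [r0, r1] is differentiated in the angle: its derivative reduces to
    values of [rotg] at r0 and r1, the contributions of the two arcs. In the bound, pi is the length
    of the parameter interval of [quarter] and pi / 4 bounds its derivative. *)
Lemma quarter_turn t r0 r1 : 0 <= t -> 0 < r0 <= r1 ->
  `|\int[mu]_(r in `[r0, r1]) rotf t r (pi / 2) -
    \int[mu]_(r in `[r0, r1]) rotf t r 0| <=
  pi * (pi / 4) * (r1 * (modbound / (b ^+ 2 + r1 ^+ 2)) +
    r0 * (modbound / (b ^+ 2 + r0 ^+ 2))).
Proof.
move=> t0 /andP[r00 r01].
have r10 : 0 < r1 by exact: lt_le_trans r01.
have p0 := pi_gt0 R.
have mB : measurable (`[r0, r1] : set (measurableTypeR R)) by exact: measurable_itv.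
pose H s := \int[mu]_(r in `[r0, r1]) rotf t r (quarter s).
have dq s : is_derive s (1 : R) quarter (pi / 4 * sin s).
  by rewrite /quarter; apply: is_derive_eq; rewrite /GRing.scale/=; ring.
have df (s r : R) : r0 <= r -> is_derive s (1 : R) (fun s : R => rotf t r (quarter s))
    (drotf t r (quarter s) * (pi / 4 * sin s)).
  move=> r0r; have r0' : 0 < r by exact: lt_le_trans r0r.
  have hq := quarter_itv s.
  exact: (is_derive_compR (is_derive_rotf kap lam0 t r0' (cos_gtN1 hq)
    (Ere_gt0 r0' hq)) (dq s)).
have [G G0 hG] := drotf_bound r1 t0.
(* Differentiation under the integral sign, followed by integration in r of the common derivative
   [drotf]. *)
have dH (s : R) : is_derive s (1 : R) H (pi / 4 * sin s * (rotg t r1 (quarter s) - rotg t r0 (quarter s))).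
  have -> : pi / 4 * sin s * (rotg t r1 (quarter s) - rotg t r0 (quarter s)) =
     \int[mu]_(r in `[r0, r1]) partial1of2 (fun s r => rotf t r (quarter s)) s r.
    rewrite -Rintegral_drotf ?r00 ?quarter_itv// -RintegralZl//; last first.
      apply: continuous_compact_integrable; first exact: segment_compact.
      apply: continuous_in_subspaceT => r; rewrite inE/= in_itv/= => /andP[r0r _].
      have r0' : 0 < r by exact: lt_le_trans r0r.
      have hq := quarter_itv s.
      exact: (continuous_drotf lam0 r0' (cos_gtN1 hq) (Ere_gt0 r0' hq)).
    apply: eq_Rintegral => r; rewrite inE/= in_itv/= => /andP[r0r _].
    by rewrite partial1of2E (@derive_val _ _ _ _ _ _ _ (df s r r0r)) mulrC.
  have Is : `]s - 1, s + 1[%classic s by rewrite /= in_itv/= ltrBlDr ltrDl ltr01.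
  have h1 : forall x, `]s - 1, s + 1[%classic x ->
      mu.-integrable `[r0, r1] (EFin \o (fun r => rotf t r (quarter x))).
    by move=> x _; apply: integrable_rotf => //; exact: quarter_itv.
  have h2 : forall x r, `]s - 1, s + 1[%classic x -> `[r0, r1]%classic r ->
      derivable (fun x => rotf t r (quarter x)) x 1.
    move=> x r _; rewrite /= in_itv/= => /andP[r0r _].
    by have h := df x r r0r; exact: ex_derive.
  have h3 : mu.-integrable `[r0, r1] (EFin \o (fun _ : R => G * (pi / 4))).
    apply: continuous_compact_integrable; first exact: segment_compact.
    by apply: continuous_subspaceT => x; exact: cvg_cst.
  have h4 : forall x r, `]s - 1, s + 1[%classic x -> `[r0, r1]%classic r ->
      `|partial1of2 (fun s r => rotf t r (quarter s)) x r| <= G * (pi / 4).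
    move=> x r _; rewrite /= in_itv/= => /andP[r0r rr1].
    rewrite partial1of2E (@derive_val _ _ _ _ _ _ _ (df x r r0r)).
    rewrite normrM ler_pM//.
      by apply: hG; [rewrite rr1 andbT (lt_le_trans r00)|exact: quarter_itv].
    by rewrite normrM ger0_norm ?divr_ge0 ?ler_piMr ?divr_ge0 ?(ltW p0)// sin_max.
  have G40 : forall y : R, 0 <= G * (pi / 4) by move=> _; rewrite mulr_ge0// divr_ge0// ltW.
  apply: DeriveDef.
    exact: (derivable_under_integral mB Is h1 h2 G40 h3 h4).
  rewrite -derive1E.
  exact: (differentiation_under_integral mB Is h1 h2 G40 h3 h4).
(* The mean value theorem on [0, pi], whose endpoints correspond to the angles 0 and pi / 2. *)
have [s _] := @MVT _ H _ 0 pi p0 (fun s _ => dH s)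
  (continuous_subspaceT (fun s => derivable_continuous_at (@ex_derive _ _ _ _ _ _ _ (dH s)))).
have -> : H pi = \int[mu]_(r in `[r0, r1]) rotf t r (pi / 2).
  by rewrite /H /quarter cospi (_ : _ * _ = pi / 2)//; field.
have -> : H 0 = \int[mu]_(r in `[r0, r1]) rotf t r 0.
  by rewrite /H /quarter cos0 subrr mulr0.
move=> ->; rewrite subr0 normrM (gtr0_norm p0).
set S := (X in _ <= _ * X); rewrite [leRHS](_ : _ = pi / 4 * S * pi); last by ring.
rewrite ler_pM2r// normrM; apply: ler_pM => //.
  rewrite normrM (ger0_norm (_ : 0 <= pi / 4)) ?divr_ge0 ?(ltW p0)//.
  by rewrite ler_piMr ?divr_ge0 ?(ltW p0)// sin_max.
have hq := quarter_itv s.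
rewrite (le_trans (ler_normB _ _))//; apply: lerD.
  exact: (norm_rotg_le t0 r10 hq).
exact: (norm_rotg_le t0 r00 hq).
Qed.

Let zero_quadrant : 0 <= (0 : R) <= pi / 2.
Proof. by rewrite lexx divr_ge0// pi_ge0. Qed.

Let pihalf_quadrant : 0 <= (pi / 2 : R) <= pi / 2.
Proof. by rewrite lexx andbT divr_ge0// pi_ge0. Qed.

Lemma integrable_modbound :
  mu.-integrable `]0, +oo[ (EFin \o (fun r => modbound / (b ^+ 2 + r ^+ 2))).
Proof.
have h : mu.-integrable `[0, +oo[ (EFin \o (fun r => modbound / (b ^+ 2 + r ^+ 2))).
  by apply: integrable_mull => //; exact: integrable_invsqrD.
apply: integrableS h => //.
by apply: subset_itvr; rewrite bnd_simp.
Qed.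

(** Truncation at both ends keeps r positive, as the derivative formulas require, and the segments
    compact; [modbound / (b ^+ 2 + r ^+ 2)] dominates. *)
Lemma cvg_Rintegral_rotf t : 0 <= t ->
  \int[mu]_(r in `[n.+1%:R^-1, n.+1%:R]) rotf t r 0 @[n --> \oo] -->
  \int[mu]_(r in `]0, +oo[) rotf t r 0.
Proof.
move=> t0.
have [||||_ c1] := @cvg_Rintegral_dominated _ _ _ mu `]0, +oo[
  (fun n => (rotf t ^~ 0) \_ `[n.+1%:R^-1, n.+1%:R]) (rotf t ^~ 0)
  (fun r => modbound / (b ^+ 2 + r ^+ 2)) (measurable_itv _).
- move=> n; apply/measurable_restrict => //.
  apply: measurable_funS (measurable_rotf al kap t lam0 b0 _) => //.
  by have := cos_gtN1 zero_quadrant; rewrite mulr0 add0r.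
- move=> r; rewrite /= in_itv/= andbT => r0.
  apply: cvg_near_cst; near=> n.
  rewrite patchE ifT// inE/= in_itv/=; apply/andP; split.
    rewrite invf_ple ?posrE// (@le_trans _ _ n%:R) ?ler_nat//.
    by near: n; exact: nbhs_infty_ger.
  rewrite (@le_trans _ _ n%:R) ?ler_nat//.
  by near: n; exact: nbhs_infty_ger.
- exact: integrable_modbound.
- move=> n r; rewrite /= in_itv/= andbT => r0.
  rewrite patchE; case: ifPn => _; first exact: norm_rotf_le.
  by rewrite normr0 divr_ge0 ?expR_ge0// ltW// sqrD_gt0.
apply: cvg_trans c1; apply: near_eq_cvg; near=> n.
rewrite -Rintegral_mkcondr setIidr// => r/=; rewrite !in_itv/= andbT => /andP[h _].
by rewrite (lt_le_trans _ h)// invr_gt0.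
Unshelve. all: end_near. Qed.

Hypothesis sin0 : 0 <= sin (al * (pi / 2) + th).

(** On the negative imaginary axis, t enters only through e^{- i t u} = e^{- t r}. *)
Lemma rotf_pihalf t r :
  rotf t r (pi / 2) = expR (- t * r) * rotf 0 r (pi / 2).
Proof.
rewrite /rotf mulrA -expRD; congr (expR _ * cos _).
  by rewrite /logmod sin_pihalf; ring.
by rewrite /phase cos_pihalf; ring.
Qed.

(** At be = pi / 2 the number b + i u = b + r is positive, so the phase is kap argD - pi / 2 and its
    cosine is sin(kap argD). The argument lies in [0, pi[ because [Dim] >= 0, and kap <= 1. *)
Lemma rotf_pihalf_ge0 r : 0 < r -> 0 <= rotf 0 r (pi / 2).
Proof.
move=> r0; rewrite /rotf mulr_ge0 ?expR_ge0//.
have sD := slitD lam0 r0 (cos_gtN1 pihalf_quadrant).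
have -> : phase lam al th kap b 0 r (pi / 2) = kap * argD lam al th r (pi / 2) - pi / 2.
  rewrite /phase /argE /Eim cos_pihalf !mulr0 /carg mul0r atan0; ring.
rewrite cosBpihalf; apply: sin_ge0_pi.
have a0 : 0 <= argD lam al th r (pi / 2).
  by apply: carg_ge0 => //; rewrite mulr_ge0// ltW// rho_gt0.
have /andP[_ a1] := carg_itv (Dre lam al r (al * (pi / 2) + th)) (Dim lam al r (al * (pi / 2) + th)).
case/andP: kap01 => k0 k1; rewrite mulr_ge0//= (le_trans _ (ltW a1))//.
by rewrite ler_piMl.
Qed.

(** On the rotated ray the integrand is nonnegative and decays like e^{- t r}, so the truncated
    integrals are ordered there. The arcs cost O(1/n), which disappears in the limit. *)
Lemma le_Rintegral_rotf t t' : 0 <= t <= t' ->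
  \int[mu]_(r in `]0, +oo[) rotf t' r 0 <= \int[mu]_(r in `]0, +oo[) rotf t r 0.
Proof.
move=> /andP[t0 tt']; have t'0 := le_trans t0 tt'.
(* With r1 = N and r0 = 1 / N, the arcs contribute at most [modbound] / N and [modbound] / (N
   b^2). *)
pose C : R := pi * (pi / 4) * (modbound * (1 + (b ^+ 2)^-1)).
have p0 := pi_gt0 R.
have M0 : 0 <= modbound by exact: expR_ge0.
have b20 : 0 < b ^+ 2 by rewrite exprn_gt0.
have turn s n : 0 <= s -> `|\int[mu]_(r in `[n.+1%:R^-1, n.+1%:R]) rotf s r (pi / 2) -
    \int[mu]_(r in `[n.+1%:R^-1, n.+1%:R]) rotf s r 0| <= C * n.+1%:R^-1.
  move=> s0; have n0 : 0 < n.+1%:R :> R by [].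
  have n1 : 1 <= n.+1%:R :> R by rewrite ler1n.
  have h : 0 < (n.+1%:R^-1 : R) <= n.+1%:R.
    by rewrite invr_gt0 n0/= (le_trans _ n1)// invf_le1.
  apply: (le_trans (quarter_turn s0 h)).
  set N := n.+1%:R in n0 n1 h *.
  rewrite [leRHS](_ : _ = pi * (pi / 4) * (N * (modbound / N ^+ 2) +
    N^-1 * (modbound / b ^+ 2))); last first.
    by rewrite /C; field; rewrite !gt_eqF.
  apply: ler_wpM2l; first by rewrite mulr_ge0 ?divr_ge0// ltW.
  have Ni : 0 < N^-1 by rewrite invr_gt0.
  apply: lerD; (apply: ler_wpM2l; first exact: ltW); apply: ler_wpM2l => //.
    by rewrite lef_pV2 ?posrE ?sqrD_gt0 ?exprn_gt0// lerDr ltW.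
  by rewrite lef_pV2 ?posrE ?sqrD_gt0// lerDl sqr_ge0.
have E n : \int[mu]_(r in `[n.+1%:R^-1, n.+1%:R]) rotf t' r 0 <=
    \int[mu]_(r in `[n.+1%:R^-1, n.+1%:R]) rotf t r 0 + 2 * C * n.+1%:R^-1.
  have h1 := turn t n t0; have h2 := turn t' n t'0.
  have h3 : \int[mu]_(r in `[n.+1%:R^-1, n.+1%:R]) rotf t' r (pi / 2) <=
      \int[mu]_(r in `[n.+1%:R^-1, n.+1%:R]) rotf t r (pi / 2).
    have n0 : 0 < n.+1%:R^-1 :> R by rewrite invr_gt0.
    apply: le_Rintegral => //.
    - exact: integrable_rotf n0 pihalf_quadrant.
    - exact: integrable_rotf n0 pihalf_quadrant.
    - move=> r; rewrite /= in_itv/= => /andP[rn _].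
      have r0 : 0 < r by exact: lt_le_trans rn.
      rewrite rotf_pihalf [leRHS]rotf_pihalf ler_wpM2r ?rotf_pihalf_ge0//.
      by rewrite ler_expR ler_wpM2r ?(ltW r0)// lerN2.
  move: h1 h2; rewrite !ler_norml => /andP[h1 h1'] /andP[h2 h2'].
  have -> : 2 * C * n.+1%:R^-1 = C * n.+1%:R^-1 + C * n.+1%:R^-1 by ring.
  have aux (A A' Q Q' e : R) : A - Q <= e -> - e <= A' - Q' -> A' <= A ->
    Q' <= Q + (e + e) by lra.
  exact: aux h1' h2 h3.
apply: (ler_cvg_to (cvg_Rintegral_rotf t'0) _ (nearW _ E)).
rewrite -[X in _ --> X]addr0; apply: cvgD; first exact: cvg_Rintegral_rotf.
rewrite -[X in _ --> X](mulr0 (2 * C)); apply: cvgM; first exact: cvg_cst.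
exact: cvg_harmonic.
Qed.

End contour.

(** * Verification of the angle condition, and the limiting case of angle pi *)

Section edge.
Context {R : realType}.
Let mu := @lebesgue_measure R.
Variables (lam al kap b : R).
Hypotheses (lam0 : 0 < lam) (al0 : 0 < al) (kap01 : 0 <= kap <= 1) (b0 : 0 < b).

Let slitD0 th r : 0 <= cos th -> 0 < r ->
  0 < cabs (Dre lam al r (al * 0 + th)) (Dim lam al r (al * 0 + th)) + Dre lam al r (al * 0 + th).
Proof.
move=> c0 r0; apply: slitD => //.
by rewrite mulr0 add0r (lt_le_trans _ c0)// ltrN10.
Qed.

(** On the real axis cos th >= 0 gives |D| >= 1. The bound is thus uniform in th, as needed to pass
    to the limit in th. *)
Lemma norm_rotf0_le th t r : 0 <= cos th -> 0 < r ->
  `|rotf lam al th kap b t r 0| <= (b ^+ 2 + r ^+ 2)^-1.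
Proof.
move=> c0 r0; rewrite normrM ger0_norm ?expR_ge0//.
have m0 := sqrD_gt0 r b0.
apply: (@le_trans _ _ (expR (logmod lam al th kap b t r 0))).
  by rewrite ler_piMr ?expR_ge0// cos_max.
rewrite -[X in _ <= X^-1]lnK ?posrE// -expRN ler_expR /logmod sin0 mulr0 add0r.
have -> : lnE b r 0 = ln (b ^+ 2 + r ^+ 2).
  by rewrite /lnE sqnEE sin0 mulr0 addr0.
suff : 0 <= kap / 2 * lnD lam al th r 0 by lra.
rewrite mulr_ge0 ?divr_ge0//; first by case/andP: kap01.
rewrite /lnD sqnDE mulr0 add0r ln_ge0// -addrA lerDl.
have h := rho_gt0 al lam0 r0.
apply: addr_ge0; last exact: sqr_ge0.
by apply: mulr_ge0 => //; apply: mulr_ge0 => //; exact: ltW.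
Qed.

Lemma cvg_rotf_theta (th : R) (th_ : nat -> R) t r : 0 <= cos th -> 0 < r ->
  th_ n @[n --> \oo] --> th ->
  rotf lam al (th_ n) kap b t r 0 @[n --> \oo] --> rotf lam al th kap b t r 0.
Proof.
move=> c0 r0 cth.
have cD : {for th, continuous (fun th => rotf lam al th kap b t r 0)}.
  apply: derivable_continuous_at.
  have hX : is_derive th (1 : R) (fun th : R => Dre lam al r (al * 0 + th)) (- Dim lam al r (al * 0 + th)).
    by rewrite /Dre; apply: is_derive_eq; rewrite /GRing.scale/= /Dim; ring.
  have hY : is_derive th (1 : R) (fun th : R => Dim lam al r (al * 0 + th)) (rho lam al r * cos (al * 0 + th)).
    by rewrite /Dim; apply: is_derive_eq; rewrite /GRing.scale/=; ring.
  have s := slitD0 c0 r0.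
  have h1 : is_derive th (1 : R) (fun th => lnD lam al th r 0) _ := is_derive_ln_sqn hX hY (cabs_gt0 s).
  have h2 : is_derive th (1 : R) (fun th => argD lam al th r 0) _ := is_derive_carg hX hY s.
  rewrite /rotf /logmod /phase.
  exact: ex_derive.
exact: (cvg_comp _ _ cth cD).
Qed.

(** The angle increases from th to its final value in [0, pi]: the cosine is nonnegative up to pi /
    2 and decreasing afterwards. *)
Lemma cos_ge_min (th be : R) : `|th| <= pi / 2 -> 0 <= al * (pi / 2) + th <= pi ->
  0 <= be <= pi / 2 ->
  Num.min 0 (cos (al * (pi / 2) + th)) <= cos (al * be + th).
Proof.
move=> hth /andP[A0 A1] /andP[be0 be1].
have g1 : al * be + th <= al * (pi / 2) + th by rewrite lerD2r ler_pM2l.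
have g0 : th <= al * be + th by rewrite lerDr mulr_ge0// ltW.
move: hth; rewrite ler_norml => /andP[t1 t2].
have [h|h] := lerP (al * be + th) (pi / 2).
  rewrite ge_min (cos_ge0_pihalf (x := al * be + th))//.
  by rewrite h andbT (le_trans t1).
have p0 := pi_gt0 R.
rewrite ge_min; apply/orP; right.
have := g1; rewrite le_eqVlt => /predU1P[->//|g2].
have i1 : al * be + th \in `[0, pi].
  rewrite in_itv/= (le_trans g1 A1) andbT (le_trans _ (ltW h))//.
  by rewrite divr_ge0// ltW.
have i2 : al * (pi / 2) + th \in `[0, pi] by rewrite in_itv/= A0.
by apply: ltW; rewrite ltr_cos.
Qed.

Lemma le_Rintegral_rotf_lt (th t t' : R) : `|th| <= pi / 2 ->
  0 <= al * (pi / 2) + th < pi -> 0 <= t <= t' ->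
  \int[mu]_(r in `]0, +oo[) rotf lam al th kap b t' r 0 <=
  \int[mu]_(r in `]0, +oo[) rotf lam al th kap b t r 0.
Proof.
move=> hth /andP[A0 A1] tt'.
have p0 := pi_gt0 R.
(* The constant c is the maximum of 0 and minus the final cosine; it is below 1 because the final
   angle is below pi. *)
apply: (@le_Rintegral_rotf _ lam al th kap b
  (- Num.min 0 (cos (al * (pi / 2) + th)))) => //.
- rewrite oppr_ge0 ge_min lexx/= ltrNl lt_min ltrN10/= -cospi.
  by rewrite ltr_cos// in_itv/= ?lexx ?(ltW p0)// A0 ltW.
- by move=> be hbe; rewrite opprK cos_ge_min// A0 ltW.
- by rewrite sin_ge0_pi// A0 ltW.
Qed.

(** If the final angle is pi, th is lowered by 1 / (n + 1) to fall under the strict case, and both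
    integrals pass to the limit by dominated convergence. *)
Lemma le_Rintegral_rotf_le (th t t' : R) : al <= 2 -> `|th| <= pi / 2 ->
  0 <= al * (pi / 2) + th <= pi -> 0 <= t <= t' ->
  \int[mu]_(r in `]0, +oo[) rotf lam al th kap b t' r 0 <=
  \int[mu]_(r in `]0, +oo[) rotf lam al th kap b t r 0.
Proof.
move=> al2 hth /andP[A0]; rewrite le_eqVlt => /predU1P[A1|A1] tt'; last first.
  by apply: le_Rintegral_rotf_lt => //; rewrite A0.
have p1 := pihalf_ge1 R.
have p0 := pi_gt0 R.
(* Since al <= 2, a final angle pi forces th >= 0. As 1 <= pi / 2, th may then be lowered by at most
   1 without leaving [- pi / 2, pi / 2]. *)
have th0 : 0 <= th.
  have : al * (pi / 2) <= 2 * (pi / 2) by rewrite ler_pM2r// divr_gt0.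
  by rewrite (_ : 2 * (pi / 2) = pi) //; [lra|field].
pose th_ n := th - n.+1%:R^-1.
have th_itv n : `|th_ n| <= pi / 2.
  have i0 : 0 < n.+1%:R^-1 :> R by rewrite invr_gt0.
  have i1 : n.+1%:R^-1 <= 1 :> R by rewrite invf_le1// ler1n.
  move: hth; rewrite ler_norml => /andP[_ h].
  rewrite ler_norml /th_; move: i0 i1; set i := n.+1%:R^-1 => i0 i1.
  by apply/andP; split; lra.
have cos_th x : `|x| <= pi / 2 -> 0 <= cos x :> R.
  by rewrite ler_norml => h; exact: cos_ge0_pihalf.
have cth : th_ n @[n --> \oo] --> th.
  rewrite -[X in _ --> X]subr0; apply: cvgB; first exact: cvg_cst.
  exact: cvg_harmonic.
have lim s : \int[mu]_(r in `]0, +oo[) rotf lam al (th_ n) kap b s r 0 @[n --> \oo] -->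
    \int[mu]_(r in `]0, +oo[) rotf lam al th kap b s r 0.
  have [||||_ //] := @cvg_Rintegral_dominated _ _ _ mu `]0, +oo[
    (fun n r => rotf lam al (th_ n) kap b s r 0) (fun r => rotf lam al th kap b s r 0)
    (fun r => (b ^+ 2 + r ^+ 2)^-1) (measurable_itv _).
  - move=> n; apply: measurable_rotf => //.
    by rewrite (lt_le_trans _ (cos_th _ (th_itv n)))// ltrN10.
  - move=> r; rewrite /= in_itv/= andbT => r0.
    by apply: cvg_rotf_theta => //; exact: cos_th.
  - have h := integrable_invsqrD b0.
    apply: integrableS h => //.
    by apply: subset_itvr; rewrite bnd_simp.
  - move=> n r; rewrite /= in_itv/= andbT => r0.
    by apply: norm_rotf0_le => //; exact: cos_th.
have E n : \int[mu]_(r in `]0, +oo[) rotf lam al (th_ n) kap b t' r 0 <=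
  \int[mu]_(r in `]0, +oo[) rotf lam al (th_ n) kap b t r 0.
  apply: le_Rintegral_rotf_lt => //.
  have i0 : 0 < n.+1%:R^-1 :> R by rewrite invr_gt0.
  have i1 : n.+1%:R^-1 <= 1 :> R by rewrite invf_le1// ler1n.
  rewrite /th_ addrA A1; move: i0 i1; set i := n.+1%:R^-1 => i0 i1.
  by apply/andP; split; lra.
exact: (ler_cvg_to (lim t') (lim t) (nearW _ E)).
Qed.

End edge.

(** * Concavity of the distribution function *)

Section smooth_step.
Context {R : realType}.
Implicit Types y : R.

(* The distribution function of the opposite of a Gamma(2) variable. *)
Definition smooth_step y : R := (1 - Num.min y 0) * expR (Num.min y 0).

Lemma smooth_step_itv y : 0 <= smooth_step y <= 1.
Proof.
have m0 : Num.min y 0 <= 0 by rewrite ge_min lexx orbT.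
rewrite /smooth_step; move: (Num.min y 0) m0 => m m0; apply/andP; split.
  by rewrite mulr_ge0 ?expR_ge0//; lra.
have := expR_ge1Dx (- m); rewrite expRN => h.
by rewrite -ler_pdivlMr ?expR_gt0// mul1r.
Qed.

(** At 0 the two branches join with derivative 0, because the step differs from 1 by at most h^2. *)
Lemma is_derive_smooth_step y :
  is_derive y 1 smooth_step (Num.max (- y) 0 * expR y).
Proof.
have [y0|y0|->] := ltgtP y 0.
- rewrite max_l; last by rewrite oppr_ge0 ltW.
  have hd : is_derive y (1 : R) (fun z => (1 - z) * expR z) (- y * expR y).
    by apply: is_derive_eq; rewrite /GRing.scale/=; ring.
  apply: near_eq_is_derive hd.
  near=> z; rewrite /smooth_step min_l//.
  by near: z; exact: lt_le_nbhsl.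
- rewrite max_r; last by rewrite oppr_le0 ltW.
  rewrite mul0r.
  have hd : is_derive y (1 : R) (cst (1 : R)) 0 by exact: is_derive_cst.
  apply: near_eq_is_derive hd.
  near=> z; rewrite /smooth_step min_r ?subr0 ?expR0 ?mulr1//.
  by near: z; exact: lt_le_nbhsr.
- rewrite oppr0 maxxx mul0r.
  have s0 : smooth_step 0 = 1 by rewrite /smooth_step minxx subr0 expR0 mulr1.
  have bound h : `|smooth_step h - 1| <= h ^+ 2.
    have /andP[_ s1] := smooth_step_itv h.
    rewrite distrC ger0_norm ?subr_ge0// lerBlDr -lerBlDl /smooth_step.
    have [h0|h0] := lerP h 0.
      have := expR_ge1Dx h => e1.
      rewrite (@le_trans _ _ ((1 - h) * (1 + h)))//; first by nra.
      by rewrite ler_wpM2l//; lra.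
    by rewrite subr0 expR0 mulr1; nra.
  have lim : h^-1 *: (smooth_step (h *: 1 + 0) - smooth_step 0) @[h --> 0^'] --> (0 : R).
    rewrite s0; apply: norm_cvg0.
    apply: (@squeeze_cvgr _ _ _ _ (cst 0) (fun h : R => `|h|)).
    - near=> h; have h0 : h != 0 by near: h; exact: nbhs_dnbhs_neq.
      rewrite normr_ge0/= addr0 /GRing.scale/= mulr1 normrM normfV.
      rewrite ler_pdivrMl ?normr_gt0// -expr2 real_normK ?num_real//.
    - exact: cvg_cst.
    - rewrite -[X in _ --> X](@normr0 _ R); apply: cvg_norm.
      exact: cvg_within.
  apply: DeriveDef; first by apply/cvg_ex; exists 0.
  exact: (cvg_lim _ lim).
Unshelve. all: end_near. Qed.

Lemma dsmooth_step_itv y : 0 <= Num.max (- y) 0 * expR y <= 1.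
Proof.
rewrite mulr_ge0 ?expR_ge0 ?le_max ?lexx ?orbT//=.
have [h|h] := lerP (- y) 0; first by rewrite mul0r.
have := expR_ge1Dx (- y); rewrite expRN => e.
by rewrite -ler_pdivlMr ?expR_gt0// mul1r; lra.
Qed.

Lemma measurable_smooth_step : measurable_fun setT smooth_step.
Proof.
apply: derivable_measurable_fun => y.
by have [] := is_derive_smooth_step y.
Qed.

(** The step equals 1 at 0, so the limit is the indicator of the closed half-line, matching the
    convention of [dist_fun]. *)
Lemma cvg_smooth_step (z : R) :
  smooth_step (n.+1%:R * z) @[n --> \oo] --> ((0 <= z)%R%:R : R).
Proof.
have [z0|z0] := leP 0 z.
  rewrite (_ : (fun n => _) = cst 1) ?mulr1n; first exact: cvg_cst.
  apply/funext => n; rewrite /smooth_step min_r ?subr0 ?expR0 ?mulr1//.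
  by rewrite mulr_ge0.
have z1 : 0 < - z by rewrite oppr_gt0.
have h : n.+1%:R * (- z) @[n --> \oo] --> +oo.
  apply/cvgryPge => r; near=> n.
  rewrite -ler_pdivrMr// (@le_trans _ _ n%:R)//; last by rewrite ler_nat.
  by near: n; exact: nbhs_infty_ger.
have e0 : expR (- x) + x * expR (- 1 * x) @[x --> +oo] --> (0 + 0 : R).
  apply: cvgD; first exact: cvgr_expR.
  exact: cvgy_id_expRN.
rewrite addr0 in e0.
rewrite /= mulr0n; apply: cvg_trans (cvg_comp _ _ h e0).
apply: near_eq_cvg; near=> n => /=.
rewrite /smooth_step min_l; last by rewrite mulr_ge0_le0// ltW.
by rewrite mulN1r mulrN opprK; ring.
Unshelve. all: end_near. Qed.

End smooth_step.

(** * The smoothed law, its density, and removal of the smoothing *)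

Section concave_cdf.
Context {R : realType}.
Let mu := @lebesgue_measure R.
Variables (nu : probability (measurableTypeR R) R) (lam al th kap : R).
Hypotheses (lam0 : 0 < lam) (al02 : 0 < al <= 2) (kap01 : 0 <= kap <= 1).
Hypotheses (hth : `|th| <= pi / 2) (hA : 0 <= al * (pi / 2) + th <= pi).
Hypothesis cosE : forall u, 0 < u -> \int[nu]_x cos (u * x) =
  expR (- (kap / 2 * lnD lam al th u 0)) * cos (kap * argD lam al th u 0).
Hypothesis sinE : forall u, 0 < u -> \int[nu]_x sin (u * x) =
  expR (- (kap / 2 * lnD lam al th u 0)) * sin (kap * argD lam al th u 0).

Lemma bounded_integrable (f : R -> R) (M : R) : measurable_fun setT f ->
  (forall x, `|f x| <= M) -> nu.-integrable setT (EFin \o f).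
Proof.
move=> mf fM.
apply: (@le_integrableR _ _ R nu setT f (fun=> M)) => //.
exact: finite_measure_integrable_cst.
Qed.

(** The conjugate of e^{i u (t - x)} / (b - i u)^2 is e^{- i t u} e^{i u x} / (b + i u)^2. Averaging
    over x turns e^{i u x} into the characteristic function, and the real part is [rotf] at angle
    0. *)
Lemma Rintegral_kernel_ft (b t u : R) : 0 < b -> 0 < u ->
  \int[nu]_x kernel_ft b u (t - x) = rotf lam al th kap b t u 0.
Proof.
move=> b0 u0.
have m0 := sqrD_gt0 u b0; have mn := lt0r_neq0 m0.
set m := b ^+ 2 + u ^+ 2 in m0 mn.
(* The argument of e^{i t u} / (b - i u)^2, so that the kernel is cos(w - u x) / m. *)
pose w := t * u + 2 * argE b u 0.
have Ere0 : Ere b u 0 = b by rewrite /Ere sin0 mulr0 addr0.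
have Eim0 : Eim u 0 = u by rewrite /Eim cos0 mulr1.
have sl : 0 < cabs b u + b by exact: slit_pos.
have cE : cos (argE b u 0) = b / cabs b u.
  by rewrite /argE Ere0 Eim0 cos_carg.
have sE : sin (argE b u 0) = u / cabs b u.
  by rewrite /argE Ere0 Eim0 sin_carg.
have Nn : cabs b u != 0 by rewrite gt_eqF// cabs_gt0.
have Nsq : cabs b u ^+ 2 = m by exact: cabs_sqr.
have c2E : cos (2 * argE b u 0) = (b ^+ 2 - u ^+ 2) / m.
  rewrite mulr_natl cos_mulr2n cE expr_div_n Nsq /m; field; exact: mn.
have s2E : sin (2 * argE b u 0) = 2 * b * u / m.
  rewrite mulr_natl sin_mulr2n cE sE -Nsq; field; exact: Nn.
have kE x : kernel_ft b u (t - x) =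
    cos w / m * cos (u * x) + sin w / m * sin (u * x).
  rewrite /kernel_ft /w -/m mulrBr (mulrC u t) cosB sinB cosD sinD c2E s2E.
  by field.
have mc : measurable_fun setT (fun x => cos (u * x) : R).
  by apply: derivable_measurable_fun => x; exact: ex_derive.
have ms : measurable_fun setT (fun x => sin (u * x) : R).
  by apply: derivable_measurable_fun => x; exact: ex_derive.
have ic : nu.-integrable setT (EFin \o (fun x => cos (u * x))).
  by apply: (bounded_integrable (M := 1)) => // x; exact: cos_max.
have isn : nu.-integrable setT (EFin \o (fun x => sin (u * x))).
  by apply: (bounded_integrable (M := 1)) => // x; exact: sin_max.
transitivity (\int[nu]_x (cos w / m * cos (u * x) + sin w / m * sin (u * x))).
  by apply: eq_Rintegral => x _; exact: kE.
rewrite RintegralD//; [|exact: integrable_mull|exact: integrable_mull].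
rewrite !RintegralZl// cosE// sinE//.
rewrite /rotf.
have -> : logmod lam al th kap b t u 0 = - (kap / 2 * lnD lam al th u 0) - ln m.
  by rewrite /logmod /lnE Ere0 Eim0 sin0 -/m; ring.
have -> : phase lam al th kap b t u 0 = kap * argD lam al th u 0 - w.
  by rewrite /phase /w cos0; ring.
rewrite expRD (expRN (ln m)) lnK ?posrE// cosB; field.
exact: mn.
Qed.

(** Up to the factor b^2, the density at t of the law convolved with that of a negative Gamma(2)
    variable of rate b. *)
Definition smoothed (b t : R) : R := \int[nu]_x (Num.max (- (t - x)) 0 * expR (b * (t - x))).

Lemma integrable_smoothed (b t : R) : 0 < b ->
  nu.-integrable setT
    (EFin \o (fun x => Num.max (- (t - x)) 0 * expR (b * (t - x)))).
Proof.
move=> b0; apply: (bounded_integrable (M := b^-1)).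
  apply: measurable_funM.
    apply: measurable_maxr => //.
    by apply: derivable_measurable_fun => x; exact: ex_derive.
  by apply: derivable_measurable_fun => x; exact: ex_derive.
move=> x; have /andP[h0 h1] := dsmooth_step_itv (b * (t - x)).
have e : Num.max (- (b * (t - x))) 0 = b * Num.max (- (t - x)) 0.
  by rewrite maxr_pMr ?mulr0 ?mulrN// ltW.
rewrite e in h0 h1.
rewrite ger0_norm; last by rewrite mulr_ge0 ?expR_ge0// le_max lexx orbT.
by rewrite -[leRHS]mulr1 ler_pdivlMl// mulrA.
Qed.

(** The kernel inversion is inserted under the expectation; Fubini's theorem applies since the
    kernel is bounded by 1 / (b^2 + u^2) for every x. *)
Lemma smoothedE (b t : R) : 0 < b ->
  pi * smoothed b t = \int[mu]_(u in `]0, +oo[) rotf lam al th kap b t u 0.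
Proof.
move=> b0.
have ibd : mu.-integrable `]0, +oo[ (EFin \o (fun u => (b ^+ 2 + u ^+ 2)^-1)).
  have h := integrable_invsqrD b0; apply: integrableS h => //.
  by apply: subset_itvr; rewrite bnd_simp.
have mk y : measurable_fun setT (fun u : R => kernel_ft b u y).
  apply: derivable_measurable_fun => u.
  have h : (b ^+ 2 + u ^+ 2) ^+ 2 != 0 by rewrite expf_neq0// gt_eqF// sqrD_gt0.
  exact: ex_derive.
transitivity (\int[nu]_x \int[mu]_(u in `]0, +oo[) kernel_ft b u (t - x)).
  rewrite /smoothed -RintegralZl//; last exact: integrable_smoothed.
  apply: eq_Rintegral => x _.
  rewrite -kernel_inversion// -Rintegral_itv_obnd_cbnd//.
  apply: (@le_integrableR _ _ R mu `]0, +oo[ _ (fun u => (b ^+ 2 + u ^+ 2)^-1)) => //.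
    by apply: measurable_funTS; exact: mk.
  by move=> u _; exact: norm_kernel_ft.
rewrite (@Rintegral_fubini _ _ _ _ R nu (@lebesgue_measure R) setT `]0, +oo[
  (fun x u => kernel_ft b u (t - x)) (fun=> 1) (fun u => (b ^+ 2 + u ^+ 2)^-1))//.
- apply: eq_Rintegral => u; rewrite inE/= in_itv/= andbT => u0.
  exact: Rintegral_kernel_ft.
- have mA (f : R -> R) : (forall u, derivable f u 1) ->
      measurable_fun setT (fun z : R * R => f z.2).
    by move=> df; apply: measurableT_comp => //; exact: derivable_measurable_fun.
  have mB (f : R -> R) : (forall u, derivable f u 1) ->
      measurable_fun setT (fun z : R * R => f (z.2 * (t - z.1))).
    move=> df; apply: (measurableT_comp (derivable_measurable_fun df)).
    by apply: measurable_funM => //; exact: measurable_funB.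
  rewrite /kernel_ft; apply: measurable_funM.
    apply: measurable_funB; apply: measurable_funM.
    + by apply: (mA (fun u => b ^+ 2 - u ^+ 2)) => u; exact: ex_derive.
    + by apply: (mB cos) => u; exact: ex_derive.
    + by apply: (mA (fun u => 2 * b * u)) => u; exact: ex_derive.
    + by apply: (mB sin) => u; exact: ex_derive.
  apply: (mA (fun u => ((b ^+ 2 + u ^+ 2) ^+ 2)^-1)) => u.
  have h : (b ^+ 2 + u ^+ 2) ^+ 2 != 0 by rewrite expf_neq0// gt_eqF// sqrD_gt0.
  exact: ex_derive.
- exact: finite_measure_integrable_cst.
- by move=> x u _ _; rewrite mul1r; exact: norm_kernel_ft.
Qed.

Lemma smoothed_noninc (b t t' : R) : 0 < b -> 0 <= t <= t' ->
  smoothed b t' <= smoothed b t.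
Proof.
move=> b0 tt'; have p0 := pi_gt0 R.
rewrite -(ler_pM2l p0) !smoothedE//.
by apply: le_Rintegral_rotf_le => //; case/andP: al02.
Qed.

(** The distribution function of the smoothed law. *)
Definition smooth_cdf (b t : R) : R := \int[nu]_x smooth_step (b * (t - x)).

Lemma is_derive_smooth_cdf (b t : R) : 0 < b ->
  is_derive t 1 (smooth_cdf b) (b ^+ 2 * smoothed b t).
Proof.
move=> b0.
have ds (s x : R) : is_derive s (1 : R) (fun s : R => smooth_step (b * (s - x)))
    (Num.max (- (b * (s - x))) 0 * expR (b * (s - x)) * b).
  apply: is_derive_compR; first exact: is_derive_smooth_step.
  by apply: is_derive_eq; rewrite /GRing.scale/=; ring.
have mstep s : measurable_fun setT (fun x : R => smooth_step (b * (s - x))).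
  apply: (measurableT_comp (@measurable_smooth_step R)).
  by apply: derivable_measurable_fun => x; exact: ex_derive.
have Is : `]t - 1, t + 1[%classic t by rewrite /= in_itv/= ltrBlDr ltrDl ltr01.
have h1 : forall s, `]t - 1, t + 1[%classic s ->
    nu.-integrable setT (EFin \o (fun x => smooth_step (b * (s - x)))).
  move=> s _; apply: (bounded_integrable (M := 1)) => // x.
  by have /andP[h0 h1] := smooth_step_itv (b * (s - x)); rewrite ger0_norm.
have h2 : forall s x, `]t - 1, t + 1[%classic s -> setT x ->
    derivable (fun s : R => smooth_step (b * (s - x))) s 1.
  by move=> s x _ _; have [] := ds s x.
have h3 : nu.-integrable setT (EFin \o (fun _ : R => b)).
  exact: finite_measure_integrable_cst.
have h4 : forall s x, `]t - 1, t + 1[%classic s -> setT x ->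
    `|partial1of2 (fun s x => smooth_step (b * (s - x))) s x| <= b.
  move=> s x _ _; rewrite partial1of2E (@derive_val _ _ _ _ _ _ _ (ds s x)).
  have /andP[g0 g1] := dsmooth_step_itv (b * (s - x)).
  by rewrite normrM ger0_norm// gtr0_norm// ler_piMl// ltW.
have b_ge0 : forall x : R, 0 <= b by move=> _; exact: ltW.
apply: DeriveDef.
  exact: (derivable_under_integral measurableT Is h1 h2 b_ge0 h3 h4).
rewrite -derive1E.
rewrite (differentiation_under_integral measurableT Is h1 h2 b_ge0 h3 h4).
rewrite /smoothed -RintegralZl//; last exact: integrable_smoothed.
apply: eq_Rintegral => x _.
rewrite partial1of2E (@derive_val _ _ _ _ _ _ _ (ds t x)).
by rewrite -mulrN -(mulr0 b) -maxr_pMr ?ltW// mulr0; ring.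
Qed.

(** The derivative is nonincreasing on t > 0. The mean value theorem on both sides of z compares the
    slopes, and p (z - x) = (1 - p)(y - z) balances them. *)
Lemma smooth_cdf_concave (b x y p : R) : 0 < b -> 0 < x -> x <= y -> 0 <= p <= 1 ->
  p * smooth_cdf b x + (1 - p) * smooth_cdf b y <=
  smooth_cdf b (p * x + (1 - p) * y).
Proof.
move=> b0 x0 xy /andP[p0 p1].
set z := p * x + (1 - p) * y.
have xz : x <= z by rewrite /z; nra.
have zy : z <= y by rewrite /z; nra.
have mvt s s' : 0 < s -> s <= s' -> exists2 c, s <= c <= s' &
    smooth_cdf b s' - smooth_cdf b s = b ^+ 2 * smoothed b c * (s' - s).
  move=> s0; rewrite le_eqVlt => /predU1P[<-|ss'].
    by exists s; [rewrite lexx|rewrite !subrr mulr0].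
  have [c] := @MVT _ (smooth_cdf b) _ s s' ss'
    (fun c _ => is_derive_smooth_cdf c b0)
    (continuous_subspaceT (fun c => derivable_continuous_at
      (@ex_derive _ _ _ _ _ _ _ (is_derive_smooth_cdf c b0)))).
  by rewrite in_itv/= => /andP[sc cs'] e; exists c => //; rewrite !ltW.
have [c1 /andP[xc1 c1z] e1] := mvt x z x0 xz.
have [c2 /andP[zc2 c2y] e2] := mvt z y (lt_le_trans x0 xz) zy.
have le21 : smoothed b c2 <= smoothed b c1.
  apply: smoothed_noninc => //.
  by rewrite (le_trans c1z zc2) andbT (le_trans (ltW x0)).
have e3 : p * (z - x) = (1 - p) * (y - z) by rewrite /z; ring.
have b2 : 0 <= b ^+ 2 by rewrite sqr_ge0.
have w0 : 0 <= p * (z - x) by rewrite mulr_ge0// subr_ge0.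
have : (1 - p) * (smooth_cdf b y - smooth_cdf b z) <=
    p * (smooth_cdf b z - smooth_cdf b x).
  rewrite e1 e2; move: (smoothed b c1) (smoothed b c2) le21 => q1 q2 le21.
  have -> : (1 - p) * (b ^+ 2 * q2 * (y - z)) = b ^+ 2 * q2 * (p * (z - x)).
    by rewrite e3; ring.
  have -> : p * (b ^+ 2 * q1 * (z - x)) = b ^+ 2 * q1 * (p * (z - x)) by ring.
  by apply: ler_wpM2r => //; exact: ler_wpM2l.
have aux (F1 F2 F3 : R) : (1 - p) * (F2 - F3) <= p * (F3 - F1) ->
    p * F1 + (1 - p) * F2 <= F3.
  rewrite -subr_ge0 => h; rewrite -subr_ge0.
  suff <- : p * (F3 - F1) - (1 - p) * (F2 - F3) = F3 - (p * F1 + (1 - p) * F2).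
    exact: h.
  by ring.
exact: aux.
Qed.

Lemma cvg_smooth_cdf t :
  smooth_cdf n.+1%:R t @[n --> \oo] --> fine (nu `]-oo, t]%classic).
Proof.
have [||||_ c1] := @cvg_Rintegral_dominated _ _ _ nu setT
  (fun n x => smooth_step (n.+1%:R * (t - x)))
  (fun x => \1_(`]-oo, t]%classic : set R) x) (fun=> 1) measurableT.
- move=> n; apply: (measurableT_comp (@measurable_smooth_step R)).
  by apply: derivable_measurable_fun => x; exact: ex_derive.
- move=> x _; have := @cvg_smooth_step R (t - x).
  by rewrite indicE mem_setE in_itv/= subr_ge0.
- exact: finite_measure_integrable_cst.
- move=> n x _; have /andP[g0 g1] := smooth_step_itv (n.+1%:R * (t - x)).
  by rewrite ger0_norm.
apply: cvg_trans c1 _.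
by rewrite /Rintegral integral_indic// setIT.
Qed.

Lemma cdf_concave (x y p : R) : 0 < x -> 0 < y -> 0 <= p <= 1 ->
  p * fine (nu `]-oo, x]%classic) + (1 - p) * fine (nu `]-oo, y]%classic) <=
  fine (nu `]-oo, (p * x + (1 - p) * y)]%classic).
Proof.
wlog xy : x y p / x <= y.
  move=> wl x0 y0 p01.
  have [xy|yx] := leP x y; first exact: wl.
  have p01' : 0 <= 1 - p <= 1.
    by case/andP: p01 => p0 p1; apply/andP; split; lra.
  have := wl y x (1 - p) (ltW yx) y0 x0 p01'; rewrite subKr => h.
  by rewrite addrC (addrC (p * x)).
move=> x0 y0 p01.
have c1 : p * smooth_cdf n.+1%:R x + (1 - p) * smooth_cdf n.+1%:R y @[n --> \oo] -->
    p * fine (nu `]-oo, x]%classic) + (1 - p) * fine (nu `]-oo, y]%classic).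
  by apply: cvgD; (apply: cvgM; [exact: cvg_cst|exact: cvg_smooth_cdf]).
have c2 := @cvg_smooth_cdf (p * x + (1 - p) * y).
apply: (ler_cvg_to c1 c2).
by apply: nearW => n; exact: smooth_cdf_concave.
Qed.

End concave_cdf.

(** * Polar form of the characteristic function *)

Section polar.
Context {R : realType}.
Local Open Scope complex_scope.

(** Off the slit both arguments have cosine X / |z|, and the sign of [carg] follows that of Y. *)
Lemma principal_argE (X Y : R) : 0 < cabs X Y + X ->
  principal_arg (X +i* Y) = carg X Y.
Proof.
move=> h; rewrite /principal_arg /=.
rewrite -[Num.sqrt _]/(cabs X Y) -cos_carg//.
have /andP[c1 c2] := carg_itv X Y.
have [Y0|Y0] := leP 0 Y.
  by rewrite cosK// in_itv/= carg_ge0//= ltW.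
have a0 : carg X Y <= 0.
  by rewrite -[Y]opprK cargN oppr_le0 carg_ge0 ?oppr_ge0 ?(ltW Y0)// /cabs sqrrN.
rewrite -cosN cosK ?opprK// in_itv/= oppr_ge0 a0/= lerNl ltW//.
Qed.

Lemma inv_polar (c t : R) : c != 0 -> 1 / (c%:C * expi t) = (c^-1 * cos t) +i* (- (c^-1 * sin t)).
Proof.
move=> c0; apply: (canLR (mulfK _)).
  rewrite mulf_eq0 negb_or; apply/andP; split.
    by apply: contra c0 => /eqP [->].
  apply/eqP => -[c1 s1]; have := cos2Dsin2 t.
  by rewrite c1 s1 expr0n/= addr0 => /eqP; rewrite eq_sym oner_eq0.
rewrite /expi; simpc.
have h : sin t ^+ 2 = 1 - cos t ^+ 2 by rewrite -(cos2Dsin2 t); ring.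
by congr (_ +i* _); field: h.
Qed.

(** For u > 0 the base of the root is [Dre] - i [Dim]; inversion changes the sign of the argument,
    whence the positive phase kap argD at angle 0. *)
Lemma linnik_cfE (lam al th : R) (k : nat) (u : R) : (1 <= k)%N -> 0 < lam ->
  -1 < cos th -> 0 < u ->
  linnik_cf lam al th k u =
  (expR (- (k%:R^-1 / 2 * lnD lam al th u 0)) * cos (k%:R^-1 * argD lam al th u 0)) +i*
  (expR (- (k%:R^-1 / 2 * lnD lam al th u 0)) * sin (k%:R^-1 * argD lam al th u 0)).
Proof.
move=> k1 lam0 cth u0.
have hD : 0 < cabs (Dre lam al u th) (Dim lam al u th) + Dre lam al u th.
  by have := @slitD _ lam al th lam0 u 0 u0; rewrite mulr0 add0r; apply.
rewrite /linnik_cf gtr0_sg// mulr1 gtr0_norm//.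
have -> : 1 + (lam * u `^ al)%:C * expi (- th) =
    Dre lam al u th +i* (- Dim lam al u th).
  rewrite /expi cosN sinN /Dre /Dim /rho; simpc.
  by congr (_ +i* _); ring.
rewrite /principal_root principal_argE; last by rewrite /cabs sqrrN.
have -> : ComplexField.Normc.normc (Dre lam al u th +i* (- Dim lam al u th)) =
    cabs (Dre lam al u th) (Dim lam al u th).
  by rewrite /= sqrrN.
have N0 := cabs_gt0 hD.
rewrite inv_polar; last by rewrite gt_eqF// powR_gt0.
have -> : lnD lam al th u 0 = 2 * ln (cabs (Dre lam al u th) (Dim lam al u th)).
  by rewrite /lnD mulr0 add0r -cabs_sqr lnXn// mulr_natl.
have -> : argD lam al th u 0 = carg (Dre lam al u th) (Dim lam al u th).
  by rewrite /argD mulr0 add0r.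
have -> : (cabs (Dre lam al u th) (Dim lam al u th) `^ k%:R^-1)^-1 =
    expR (- (k%:R^-1 / 2 * (2 * ln (cabs (Dre lam al u th) (Dim lam al u th))))).
  rewrite expRN /powR gt_eqF//; congr (expR _)^-1; field.
  by rewrite pnatr_eq0 -lt0n.
rewrite cargN mulNr cosN sinN mulrN opprK.
by congr ((_ * cos _) +i* (_ * sin _)); rewrite mulrC.
Qed.

End polar.

(** * Reflection of the law and right continuity *)

Section reflection.
Context {R : realType}.

Definition reflect (x : measurableTypeR R) : measurableTypeR R := - x.

Lemma measurable_reflect : measurable_fun setT reflect.
Proof. exact: measurable_funN. Qed.

HB.instance Definition _ := isMeasurableFun.Build _ _ _ _ reflect measurable_reflect.

Variable mu : probability (measurableTypeR R) R.

Lemma Rintegral_reflect (f : R -> R) (M : R) : measurable_fun setT f ->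
  (forall x, `|f x| <= M) ->
  \int[distribution mu reflect]_x f x = \int[mu]_x f (- x).
Proof.
move=> mf fM; rewrite /Rintegral integral_distribution//.
  exact/measurable_EFinP.
apply: (bounded_integrable mu (M := M)) => //.
by apply: measurableT_comp => //; exact: measurable_reflect.
Qed.

Lemma cvg_dist_fun (x : R) :
  dist_fun mu (x + n.+1%:R^-1) @[n --> \oo] --> dist_fun mu x.
Proof.
apply: fine_cvg; rewrite fineK ?fin_num_measure// (itvNycEbigcap false).
apply: nonincreasing_cvg_mu => //.
- by rewrite ltey_eq fin_num_measure.
- exact: bigcap_measurable.
- move=> m n mn; apply/subsetPset; apply: subset_itvl.
  by rewrite bnd_simp lerD2l lef_pV2 ?posrE// ler_nat.
Qed.

End reflection.

(** * Concavity on the positive half-line for the law and its reflection *)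

Section linnik.
Context {R : realType}.

(** The two entries of the minimum add up to pi, so their minimum is at most pi / 2. *)
Lemma le_theta_pihalf (al th : R) : 0 < al <= 2 ->
  `|th| <= Num.min (pi * al / 2) (pi - pi * al / 2) ->
  `|th| <= pi / 2 /\ 0 <= al * (pi / 2) + th <= pi.
Proof.
rewrite le_min => _ /andP[h1 h2].
have -> : al * (pi / 2) = pi * al / 2 by field.
split; first lra.
by move: h1 h2; rewrite !ler_norml => /andP[? ?] /andP[? ?]; apply/andP; split; lra.
Qed.

(** Reflection conjugates the characteristic function, which amounts to replacing theta by - theta;
    the condition on theta is symmetric. *)
Lemma linnik_cdf_concave (mu : probability (measurableTypeR R) R)
    (lam al th : R) (k : nat) :
  (1 <= k)%N -> 0 < lam -> 0 < al <= 2 ->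
  `|th| <= Num.min (pi * al / 2) (pi - pi * al / 2) ->
  (forall u : R, char_fun mu u = linnik_cf lam al th k u) ->
  (forall x y p, 0 < x -> 0 < y -> 0 <= p <= 1 ->
    p * dist_fun mu x + (1 - p) * dist_fun mu y <=
    dist_fun mu (p * x + (1 - p) * y)) /\
  (forall x y p, 0 < x -> 0 < y -> 0 <= p <= 1 ->
    p * dist_fun (distribution mu reflect) x +
    (1 - p) * dist_fun (distribution mu reflect) y <=
    dist_fun (distribution mu reflect) (p * x + (1 - p) * y)).
Proof.
move=> k1 lam0 al02 hth hcf.
have [th1 th2] := le_theta_pihalf al02 hth.
have [th1' th2'] : `|- th| <= pi / 2 /\ 0 <= al * (pi / 2) + - th <= pi.
  by apply: le_theta_pihalf => //; rewrite normrN.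
have cth : -1 < cos th.
  rewrite (@lt_le_trans _ _ 0) ?ltrN10//; apply: cos_ge0_pihalf.
  by rewrite -ler_norml.
have kap01 : 0 <= (k%:R^-1 : R) <= 1.
  by rewrite invr_ge0 ler0n invf_le1 ?ltr0n// ler1n.
have cosE u : 0 < u -> \int[mu]_x cos (u * x) =
    expR (- (k%:R^-1 / 2 * lnD lam al th u 0)) * cos (k%:R^-1 * argD lam al th u 0).
  by move=> u0; have := hcf u; rewrite linnik_cfE// => -[].
have sinE u : 0 < u -> \int[mu]_x sin (u * x) =
    expR (- (k%:R^-1 / 2 * lnD lam al th u 0)) * sin (k%:R^-1 * argD lam al th u 0).
  by move=> u0; have := hcf u; rewrite linnik_cfE// => -[].
have lnDN u : lnD lam al (- th) u 0 = lnD lam al th u 0.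
  by rewrite /lnD !mulr0 !add0r /Dre /Dim cosN sinN mulrN sqrrN.
have argDN u : argD lam al (- th) u 0 = - argD lam al th u 0.
  by rewrite /argD !mulr0 !add0r /Dre /Dim cosN sinN mulrN cargN.
split=> x y p x0 y0 p01.
  exact: (cdf_concave lam0 al02 kap01 th1 th2 cosE sinE x0 y0 p01).
apply: (cdf_concave lam0 al02 kap01 th1' th2' _ _ x0 y0 p01) => u u0.
  rewrite (@Rintegral_reflect _ _ _ 1); last by move=> z; exact: cos_max.
    rewrite lnDN argDN mulrN cosN -cosE//.
    by apply: eq_Rintegral => z _; rewrite mulrN cosN.
  by apply: derivable_measurable_fun => z; exact: ex_derive.
have ms : measurable_fun setT (fun z : R => sin (u * z)).
  by apply: derivable_measurable_fun => z; exact: ex_derive.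
rewrite (@Rintegral_reflect _ _ _ 1)//; last by move=> z; exact: sin_max.
rewrite lnDN argDN mulrN sinN mulrN -sinE//.
transitivity (\int[mu]_z (-1 * sin (u * z))).
  by apply: eq_Rintegral => z _; rewrite mulrN sinN mulN1r.
rewrite RintegralZl ?mulN1r//.
by apply: (bounded_integrable mu (M := 1)) => // z; exact: sin_max.
Qed.

End linnik.

Theorem theorem2p4 (R : realType) (k : nat) (lambda alpha theta : R)
    (mu : probability (measurableTypeR R) R) :
  (1 <= k)%N ->
  0 < lambda ->
  0 < alpha <= 2 ->
  `|theta| <= Num.min (pi * alpha / 2) (pi - pi * alpha / 2) ->
  (forall u : R, char_fun mu u = linnik_cf lambda alpha theta k u) ->
  unimodal mu.
Proof.
move=> k1 lam0 al02 hth hcf.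
have [concR concL] := linnik_cdf_concave k1 lam0 al02 hth hcf.
exists 0; split; last first.
  move=> p x y; rewrite !inE/= !in_itv/= !andbT => x0 y0.
  have p01 : 0 <= (p%:num : R) <= 1 by apply/andP; split.
  have := concR x y p%:num x0 y0 p01.
  by rewrite -lerN2 opprD -!mulrN.
(* The reflected distribution function at z is 1 - P(X < - z). Its concavity therefore gives
   convexity of [Fm], with open half-lines, on z < 0. *)
pose Fm (z : R) := fine (mu `]-oo, z[%classic).
have GE z : dist_fun (distribution mu reflect) z = 1 - Fm (- z).
  transitivity (fine (mu (~` `]-oo, - z[%classic))).
    have -> : ~` `]-oo, - z[%classic = (reflect : R -> R) @^-1` `]-oo, z]%classic.
      apply/seteqP; split => x /=; rewrite /reflect !in_itv/=.
        by move/negP; rewrite -leNgt lerNl.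
      by rewrite lerNl => h; apply/negP; rewrite -leNgt.
    by [].
  by rewrite probability_setC// fineB// ?fin_num_measure.
have FmF z : Fm z <= dist_fun mu z.
  rewrite /Fm fine_le ?fin_num_measure// le_measure ?inE//.
  by apply: subset_itvl; rewrite bnd_simp.
have FFm z d : 0 < d -> dist_fun mu z <= Fm (z + d).
  move=> d0; rewrite /Fm fine_le ?fin_num_measure// le_measure ?inE//.
  by apply: subset_itvl; rewrite bnd_simp ltrDl.
have convL x y p : x < 0 -> y < 0 -> 0 <= p <= 1 ->
    Fm (p * x + (1 - p) * y) <= p * Fm x + (1 - p) * Fm y.
  move=> x0 y0 p01; have := concL (- x) (- y) p.
  rewrite !GE !oppr_gt0 => /(_ x0 y0 p01).
  rewrite !opprK !mulrN -opprD opprK.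
  set a := Fm x; set b := Fm y; set c := Fm _.
  have -> : p * (1 - a) + (1 - p) * (1 - b) = 1 - (p * a + (1 - p) * b) by ring.
  by rewrite lerD2l lerN2.
move=> p x y; rewrite !inE/= !in_itv/= => x0 y0.
have p01 : 0 <= (p%:num : R) <= 1 by apply/andP; split.
(* Passage from [Fm] to [dist_fun]: F(z) <= Fm(z + d) and Fm <= F give the convexity inequality with
   x and y shifted by d = 1 / (n + 1), and right continuity removes the shift. *)
have : p%:num * dist_fun mu (x + n.+1%:R^-1) + (1 - p%:num) * dist_fun mu (y + n.+1%:R^-1)
    @[n --> \oo] --> p%:num * dist_fun mu x + (1 - p%:num) * dist_fun mu y.
  by apply: cvgD; (apply: cvgM; [exact: cvg_cst|exact: cvg_dist_fun]).
move=> lim.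
apply: (ler_cvg_to (cvg_cst (dist_fun mu (p%:num * x + (1 - p%:num) * y))) lim).
have small (z : R) : z < 0 -> \forall n \near \oo, z + n.+1%:R^-1 < 0.
  move=> z0.
  have : z + m.+1%:R^-1 @[m --> \oo] --> z + 0.
    by apply: cvgD; [exact: cvg_cst|exact: cvg_harmonic].
  by rewrite addr0 => /cvgr_lt; apply.
near=> n.
have i0 : 0 < n.+1%:R^-1 :> R by rewrite invr_gt0.
have xn : x + n.+1%:R^-1 < 0 by near: n; exact: small.
have yn : y + n.+1%:R^-1 < 0 by near: n; exact: small.
apply: (le_trans (FFm _ _ i0)).
have -> : p%:num * x + (1 - p%:num) * y + n.+1%:R^-1 =
  p%:num * (x + n.+1%:R^-1) + (1 - p%:num) * (y + n.+1%:R^-1) by ring.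
apply: (le_trans (convL _ _ _ xn yn p01)).
case/andP: p01 => p0 p1.
by apply: lerD; apply: ler_wpM2l; rewrite ?subr_ge0 ?FmF.
Unshelve. all: end_near. Qed.
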